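(* For every $n\in\mathbb N\cup\{\infty\}$ and every $M\in\mathrm{Rep}_{\mathfrak g_{\bar0}}\mathfrak{gl}(1|1)$ there is a canonical isomorphism in $\mathrm{Rep}\,\mathfrak g_m$: $$DS^n_{x,y}(M^\vee)\cong(DS^n_{y,x}M)^\vee.$$
   Context: Everything is over $\mathbb C$ and in the super setting. $\mathfrak{gl}(1|1)$ has basis $h,c$ (even), $x,y$ (odd), with $c$ central, $[h,x]=x$, $[h,y]=-y$, $[x,y]=c$, $[x,x]=[y,y]=0$. $\mathrm{Rep}_{\mathfrak g_{\bar 0}}\mathfrak{gl}(1|1)$ is the category of finite-dimensional modules on which $h,c$ act semisimply. $\mathrm{Rep}\,\mathfrak g_m$ is the category of finite-dimensional super vector spaces with a semisimple action of an even operator $h$. Definition of $DS^n_{y,x}V$. Let $V^c=\{v\in V:cv=0\}$. For $r\ge1$ an $r$-chain is a sequence $(v_1,\dots,v_r)$ in $V^c$ with $yv_i=xv_{i+1}$ for $1\le i\le r-1$ and $yv_r=0$. Put $Z_0=V^c$, $Z_r=\{v_r:\exists\ r\text{-chain }(v_1,\dots,v_r)\}$ for $r>0$, $B_0=0$, $B_1=y V^c$, $B_r=yV^c+\{xw_1:\exists\ (r-1)\text{-chain }(w_1,\dots,w_{r-1})\}$ for $r>1$. Then $DS^n_{y,x}V:=Z_n/B_n$ with the induced $h$-action. For finite-dimensional $V$ this stabilizes for large $n$ and $DS^\infty_{y,x}V$ is the stable value. $DS^n_{x,y}$, $DS^\infty_{x,y}$ are defined in the same way with $x$ and $y$ interchanged.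 Contragredient duality: for a $\mathfrak{gl}(1|1)$-module, $V^\vee$ is $V^*$ with $u\in\mathfrak{gl}(1|1)$ acting as $\sigma(u)$, where $\sigma(h)=-h,\sigma(c)=-c,\sigma(x)=-y,\sigma(y)=x$. In $\mathrm{Rep}\,\mathfrak g_m$, $N^\vee$ is the dual $N^*$ twisted by $h\mapsto-h$, i.e. $(h\varphi)(v)=\varphi(hv)$. ''Canonical'' means natural in $M$. *)

(* Defs.v *)
From HB Require Import structures.
From mathcomp Require Import all_boot all_order all_algebra.
From mathcomp Require Import boolp classical_sets reals.
From mathcomp Require Import complex.

Set Implicit Arguments.
Unset Strict Implicit.
Unset Printing Implicit Defensive.

Import GRing.Theory.
Local Open Scope ring_scope.
Local Open Scope quotient_scope.

Lemma linfunE (F : fieldType) (V W : vectType F) (f : V -> W) :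
  linear f -> linfun f =1 f.
Proof.
move=> lf; pose m := GRing.isLinear.Build F V W *:%R f lf.
pose g : {linear V -> W} := HB.pack f m.
exact: (lfunE g).
Qed.

Section Quotient.
Import VectorInternalTheory.
Variables (F : fieldType) (V : vectType F) (U : {vspace V}).

Definition quotv := Quotient.quot (pred_of_vspace U).

HB.instance Definition _ := GRing.Zmodule.on quotv.

Definition quotv_pi (v : V) : quotv := \pi_(Quotient.quot (pred_of_vspace U)) v.
Definition quotv_repr (q : quotv) : V := repr q.

Lemma quotv_reprK q : quotv_pi (quotv_repr q) = q.
Proof. exact: reprK. Qed.

Lemma quotv_piP v w : (quotv_pi v = quotv_pi w) <-> (v - w \in U).
Proof. by rewrite (Quotient.idealrBE (pred_of_vspace U)); split=> /eqP. Qed.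

Lemma quotv_piB : {morph quotv_pi : v w / v - w}.
Proof. by move=> v w; rewrite /quotv_pi; exact: raddfB. Qed.

Lemma quotv_piD : {morph quotv_pi : v w / v + w}.
Proof. by move=> v w; rewrite /quotv_pi; exact: raddfD. Qed.

Definition quotv_scale (a : F) (q : quotv) : quotv :=
  quotv_pi (a *: quotv_repr q).

Lemma quotv_piZ a v : quotv_scale a (quotv_pi v) = quotv_pi (a *: v).
Proof.
apply/quotv_piP; rewrite -scalerBr; apply: memvZ.
by apply/quotv_piP; rewrite quotv_reprK.
Qed.

Fact quotv_scaleA a b q : quotv_scale a (quotv_scale b q) = quotv_scale (a * b) q.
Proof. by rewrite -[q]quotv_reprK !quotv_piZ scalerA. Qed.
Fact quotv_scale1 : left_id 1 quotv_scale.
Proof. by move=> q; rewrite -[q]quotv_reprK quotv_piZ scale1r. Qed.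
Fact quotv_scaleDr : right_distributive quotv_scale +%R.
Proof.
move=> a q r; rewrite -[q]quotv_reprK -[r]quotv_reprK -quotv_piD !quotv_piZ.
by rewrite -quotv_piD scalerDr.
Qed.
Fact quotv_scaleDl q : {morph quotv_scale^~ q : a b / a + b}.
Proof.
by move=> a b; rewrite -[q]quotv_reprK !quotv_piZ -quotv_piD scalerDl.
Qed.

HB.instance Definition _ := GRing.Zmodule_isLmodule.Build F quotv
  quotv_scaleA quotv_scale1 quotv_scaleDr quotv_scaleDl.

Lemma quotv_pi_linear : linear quotv_pi.
Proof. by move=> a v w; rewrite quotv_piD -quotv_piZ. Qed.

Let W := (U^C)%VS.
Let iso (q : quotv) : subvs_of W := vsproj W (quotv_repr q - projv U (quotv_repr q)).
Let osi (w : subvs_of W) : quotv := quotv_pi (vsval w).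

Let isoE v : iso (quotv_pi v) = vsproj W (v - projv U v).
Proof.
congr vsproj; set r := quotv_repr _.
have rvU : r - v \in U by apply/quotv_piP; rewrite [LHS]quotv_reprK.
have -> : r = v + (r - v) by rewrite addrC subrK.
by rewrite linearD /= (projv_id rvU) opprD addrACA subrr addr0.
Qed.

Fact quotv_vect_iso : Vector.axiom (dim (subvs_of W)) quotv.
Proof.
have lin_iso : linear iso.
  move=> a q r; rewrite -[q]quotv_reprK -[r]quotv_reprK -quotv_pi_linear !isoE.
  rewrite -linearP /=; congr vsproj.
  by rewrite linearP /= scalerBr opprD addrACA.
exists (v2r \o iso); first by move=> a q r /=; rewrite lin_iso linearP.
exists (osi \o r2v) => [q|r] /=; rewrite ?v2rK.
  rewrite /osi /iso vsprojK ?memv_projC // -[RHS]quotv_reprK.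
  by apply/quotv_piP; rewrite addrAC subrr sub0r memvN memv_proj.
rewrite /osi isoE; set w := r2v r.
suff -> : projv U (vsval w) = 0 by rewrite subr0 vsvalK r2vK.
by apply/eqP; rewrite -memv_ker lker_proj subvsP.
Qed.

HB.instance Definition _ := Lmodule_hasFinDim.Build F quotv quotv_vect_iso.

End Quotient.

Section Subquotient.
Variables (F : fieldType) (V : vectType F) (Z B : {vspace V}).

(* Z / (Z :&: B); only used when B <= Z. *)
Definition subquot : vectType F :=
  quotv (linfun (vsval : subvs_of Z -> V) @^-1: B)%VS.

(* The class of z, meaningful for z in Z. *)
Definition sq_pi (z : V) : subquot := quotv_pi _ (vsproj Z z).
Definition sq_repr (q : subquot) : V := vsval (quotv_repr q).

Lemma sq_pi_linear : linear sq_pi.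
Proof. by move=> a u v; rewrite /sq_pi linearP quotv_pi_linear. Qed.

HB.instance Definition _ := GRing.isLinear.Build F V subquot *:%R sq_pi sq_pi_linear.

Lemma sq_reprZ q : sq_repr q \in Z.
Proof. exact: subvsP. Qed.

Lemma sq_reprK q : sq_pi (sq_repr q) = q.
Proof. by rewrite /sq_pi /sq_repr vsvalK quotv_reprK. Qed.

Lemma sq_piP u v : u \in Z -> v \in Z -> sq_pi u = sq_pi v <-> u - v \in B.
Proof.
move=> uZ vZ; rewrite quotv_piP -memv_preim lfunE.
by rewrite linearB /= !vsprojK.
Qed.

Lemma sq_pi0 u : u \in Z -> sq_pi u = 0 <-> u \in B.
Proof.
move=> uZ; rewrite -(linear0 sq_pi).
by rewrite sq_piP ?mem0v // subr0.
Qed.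

Lemma sq_repr_pi u : u \in Z -> sq_repr (sq_pi u) - u \in B.
Proof. by move=> uZ; apply/sq_piP; rewrite ?sq_reprZ ?sq_reprK. Qed.

End Subquotient.

Definition sq_map (F : fieldType) (V V' : vectType F) (Z B : {vspace V})
    (Z' B' : {vspace V'}) (f : 'Hom(V, V')) : 'Hom(subquot Z B, subquot Z' B') :=
  linfun (fun q => sq_pi Z' B' (f (sq_repr q))).

Section SubquotientMap.
Variables (F : fieldType) (V V' : vectType F) (Z B : {vspace V}).
Variables (Z' B' : {vspace V'}) (f : 'Hom(V, V')).
Hypothesis (fZ : forall z, z \in Z -> f z \in Z').
Hypothesis (fB : forall z, z \in B -> f z \in B').

Let sq_map_rep u : u \in Z ->
  sq_pi Z' B' (f (sq_repr (sq_pi Z B u))) = sq_pi Z' B' (f u).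
Proof.
move=> uZ; apply/sq_piP; rewrite ?fZ ?sq_reprZ // -linearB.
exact/fB/sq_repr_pi.
Qed.

Lemma sq_mapE u : u \in Z -> sq_map Z B Z' B' f (sq_pi Z B u) = sq_pi Z' B' (f u).
Proof.
move=> uZ; rewrite linfunE ?sq_map_rep // => a q r.
rewrite -[q]sq_reprK -[r]sq_reprK.
rewrite -[_ *: sq_pi Z B _ + _]sq_pi_linear !sq_map_rep ?sq_reprZ //.
  by rewrite linearP sq_pi_linear.
by rewrite memvD ?memvZ ?sq_reprZ.
Qed.

End SubquotientMap.

Definition semisimple (F : fieldType) (V : vectType F) (f : 'End(V)) : Prop :=
  forall U : {vspace V}, (f @: U <= U)%VS ->
  exists W : {vspace V},
    [/\ (f @: W <= W)%VS, (U + W)%VS = fullv & (U :&: W)%VS = 0%VS].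

Lemma stableP (F : fieldType) (V V' : vectType F) (f : 'Hom(V, V')) (U : {vspace V}) (U' : {vspace V'}) :
  reflect (forall v, v \in U -> f v \in U') (f @: U <= U')%VS.
Proof.
apply: (iffP idP) => [/subvP fU v vU|fU]; first by rewrite fU // memv_img.
by apply/subvP=> _ /memv_imgP[v vU ->]; exact: fU.
Qed.

Section Semisimple.
Variables (F : fieldType) (V : vectType F).

Lemma semisimple_subquot (f : 'End(V)) (Z B : {vspace V}) :
  (forall z, z \in Z -> f z \in Z) -> (forall z, z \in B -> f z \in B) ->
  semisimple f -> semisimple (sq_map Z B Z B f).
Proof.
move=> fZ fB ssf U /stableP fU.
have piL : linear (sq_pi Z B) := @sq_pi_linear _ _ Z B.
pose U1 := (Z :&: linfun (sq_pi Z B) @^-1: U)%VS.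
have U1P v : (v \in U1) = (v \in Z) && (sq_pi Z B v \in U).
  by rewrite memv_cap -memv_preim linfunE.
have [|W [/stableP fW sW cW]] := ssf U1.
  apply/stableP=> v; rewrite !U1P => /andP[vZ vU].
  by rewrite fZ // -(sq_mapE fZ fB) // fU.
exists (linfun (sq_pi Z B) @: (Z :&: W))%VS; split.
- apply/stableP=> _ /memv_imgP[w /memv_capP[wZ wW] ->].
  rewrite linfunE // (sq_mapE fZ fB) // -(linfunE piL) memv_img //.
  by rewrite memv_cap fZ // fW.
- apply/eqP; rewrite eqEsubv subvf; apply/subvP=> q _.
  have : sq_repr q \in (U1 + W)%VS by rewrite sW memvf.
  move=> /memv_addP[u uU [w wW e]]; move: uU; rewrite U1P => /andP[uZ uU].
  have wZ : w \in Z.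
    have -> : w = sq_repr q - u by rewrite e addrC addKr.
    by rewrite memvB ?sq_reprZ.
  rewrite -[q]sq_reprK e -(linfunE piL) linearD /= memv_add //.
    by rewrite linfunE.
  by rewrite memv_img // memv_cap wZ.
apply/eqP; rewrite -subv0; apply/subvP=> q /memv_capP[qU].
move=> /memv_imgP[w /memv_capP[wZ wW]]; rewrite linfunE // => e.
have : w \in (U1 :&: W)%VS by rewrite memv_cap wW U1P wZ -e qU.
rewrite cW memv0 => /eqP w0; rewrite e memv0; apply/eqP/sq_pi0 => //.
by rewrite w0 mem0v.
Qed.

End Semisimple.

(* [sv_part false] and [sv_part true] are the even and the odd part. *)
Record svect (F : fieldType) := SVect {
  sv_sort :> vectType F;
  sv_part : bool -> {vspace sv_sort};
  sv_add : (sv_part false + sv_part true)%VS = fullv;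
  sv_cap : (sv_part false :&: sv_part true)%VS = 0%VS }.

Definition even_map (F : fieldType) (V W : svect F) (f : 'Hom(V, W)) : Prop :=
  forall p, (f @: sv_part V p <= sv_part W p)%VS.

Definition odd_map (F : fieldType) (V W : svect F) (f : 'Hom(V, W)) : Prop :=
  forall p, (f @: sv_part V p <= sv_part W (~~ p))%VS.

Section SuperVect.
Variables (F : fieldType) (V : svect F).

Definition sv_proj (p : bool) : 'End(V) := daddv_pi (sv_part V p) (sv_part V (~~ p)).

(* v |-> (-1)^|v| v *)
Definition sv_sign : 'End(V) := sv_proj false - sv_proj true.

Lemma sv_cap_ p : (sv_part V p :&: sv_part V (~~ p))%VS = 0%VS.
Proof. by case: p => /=; [rewrite capvC|]; exact: sv_cap. Qed.

Lemma sv_projP p v : sv_proj p v \in sv_part V p.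
Proof. exact: memv_pi. Qed.

Lemma sv_proj_id p v : v \in sv_part V p -> sv_proj p v = v.
Proof. exact/daddv_pi_id/sv_cap_. Qed.

Lemma sv_proj_add v : sv_proj false v + sv_proj true v = v.
Proof. by apply: daddv_pi_add; rewrite ?sv_cap // sv_add memvf. Qed.

Lemma sv_proj_add_ p v : sv_proj p v + sv_proj (~~ p) v = v.
Proof. by case: p; rewrite ?sv_proj_add //= addrC sv_proj_add. Qed.

Lemma sv_proj0 p v : v \in sv_part V (~~ p) -> sv_proj p v = 0.
Proof.
move=> vp; have := sv_proj_add_ p v; rewrite (sv_proj_id vp) => /eqP.
by rewrite -subr_eq0 addrK => /eqP.
Qed.

Lemma sv_proj_mem p v : (v \in sv_part V p) = (sv_proj p v == v).
Proof. by apply/idP/eqP => [/sv_proj_id//|<-]; exact: sv_projP. Qed.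

Lemma sv_signE p v : v \in sv_part V p -> sv_sign v = (-1) ^+ p *: v.
Proof.
rewrite add_lfunE opp_lfunE; case: p => vp.
  by rewrite sv_proj0 // sv_proj_id // sub0r expr1 scaleN1r.
by rewrite sv_proj_id // sv_proj0 // subr0 expr0 scale1r.
Qed.

Lemma sv_eq (W : vectType F) (f g : 'Hom(V, W)) :
  (forall p v, v \in sv_part V p -> f v = g v) -> f = g.
Proof.
move=> fg; apply/lfunP=> v; rewrite -[v]sv_proj_add !linearD /=.
by congr (_ + _); apply: fg (sv_projP _ _).
Qed.

Lemma sv_signK v : sv_sign (sv_sign v) = v.
Proof.
rewrite -comp_lfunE -[RHS]id_lfunE; congr (fun_of_lfun _ v); apply: sv_eq => p u up.
rewrite comp_lfunE id_lfunE (sv_signE up) linearZ /= (sv_signE up) scalerA -signr_addb.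
by rewrite addbb expr0 scale1r.
Qed.

End SuperVect.

Section SuperMaps.
Variables (F : fieldType) (V W : svect F) (f : 'Hom(V, W)).

Lemma even_proj p v : even_map f -> f (sv_proj V p v) = sv_proj W p (f v).
Proof.
move=> ef; rewrite -{2}(sv_proj_add_ p v) !linearD /=.
rewrite [sv_proj W p _]sv_proj_id ?[sv_proj W p _]sv_proj0 ?addr0 //.
  by apply/(stableP f); [exact: ef|exact: sv_projP].
by apply/(stableP f); [exact: ef|exact: sv_projP].
Qed.

Lemma odd_proj p v : odd_map f -> f (sv_proj V p v) = sv_proj W (~~ p) (f v).
Proof.
move=> of_; rewrite -{2}(sv_proj_add_ p v) !linearD /=.
rewrite [sv_proj W _ (f (sv_proj V p v))]sv_proj_id.
  rewrite [sv_proj W _ _]sv_proj0 ?addr0 //.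
  by apply/(stableP f); [exact: of_|exact: sv_projP].
by apply/(stableP f); [exact: of_|exact: sv_projP].
Qed.

Lemma even_sign v : even_map f -> f (sv_sign V v) = sv_sign W (f v).
Proof. by move=> ef; rewrite !add_lfunE !opp_lfunE linearB /= !even_proj. Qed.

Lemma odd_sign v : odd_map f -> f (sv_sign V v) = - sv_sign W (f v).
Proof. by move=> of_; rewrite !add_lfunE !opp_lfunE linearB /= !odd_proj // opprB. Qed.

End SuperMaps.

Section SuperSubquotient.
Variables (F : fieldType) (V : svect F) (Z B : {vspace V}).
Hypothesis gZ : forall p z, z \in Z -> sv_proj V p z \in Z.
Hypothesis gB : forall p z, z \in B -> sv_proj V p z \in B.

Definition sq_part (p : bool) : {vspace subquot Z B} :=
  (linfun (sq_pi Z B) @: (Z :&: sv_part V p))%VS.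

Lemma sq_part_pi p z : z \in Z -> z \in sv_part V p -> sq_pi Z B z \in sq_part p.
Proof. by move=> zZ zp; rewrite -(lfunE (sq_pi Z B)) memv_img // memv_cap zZ. Qed.

Lemma sq_partP p q : q \in sq_part p ->
  exists2 z, z \in Z /\ z \in sv_part V p & q = sq_pi Z B z.
Proof.
by move=> /memv_imgP[z /memv_capP[? ?] ->]; exists z => //; rewrite lfunE.
Qed.

Fact sq_add : (sq_part false + sq_part true)%VS = fullv.
Proof.
apply/eqP; rewrite eqEsubv subvf; apply/subvP=> q _.
rewrite -[q]sq_reprK -[sq_repr q]sv_proj_add linearD.
by apply: memv_add; apply: sq_part_pi (sv_projP _ _); rewrite gZ ?sq_reprZ.
Qed.

Fact sq_cap : (sq_part false :&: sq_part true)%VS = 0%VS.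
Proof.
apply/eqP; rewrite -subv0; apply/subvP=> q /memv_capP[].
move=> /sq_partP[z [zZ z0] ->] /sq_partP[w [wZ w1]] /(sq_piP _ zZ wZ) zwB.
rewrite memv0; apply/eqP/sq_pi0 => //.
by have := gB false zwB; rewrite linearB /= sv_proj_id // sv_proj0 // subr0.
Qed.

Definition sv_subquot : svect F := SVect sq_add sq_cap.

End SuperSubquotient.

Section Dual.
Variables (F : fieldType) (V : svect F).

(* The functionals of parity p, i.e. those vanishing on the part of parity
   1 - p; this is the kernel of phi |-> phi \o sv_proj V (~~ p). *)
Definition dual_part (p : bool) : {vspace 'Hom(V, F^o)} :=
  lker (linfun (fun phi : 'Hom(V, F^o) => (phi \o sv_proj V (~~ p))%VF)).

Lemma dual_partP p (phi : 'Hom(V, F^o)) :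
  reflect (forall v, v \in sv_part V (~~ p) -> phi v = 0) (phi \in dual_part p).
Proof.
rewrite memv_ker linfunE; last first.
  by move=> a f g; rewrite comp_lfunDl -comp_lfunZl.
apply: (iffP eqP) => [/lfunP e v vp|e].
  by have := e v; rewrite comp_lfunE zero_lfunE sv_proj_id.
by apply/lfunP=> v; rewrite comp_lfunE zero_lfunE e // sv_projP.
Qed.

Lemma dual_part_proj p (phi : 'Hom(V, F^o)) : (phi \o sv_proj V p)%VF \in dual_part p.
Proof. by apply/dual_partP=> v vp; rewrite comp_lfunE sv_proj0 ?linear0. Qed.

Fact dual_add : (dual_part false + dual_part true)%VS = fullv.
Proof.
apply/eqP; rewrite eqEsubv subvf; apply/subvP=> phi _.
have -> : phi = (phi \o sv_proj V false)%VF + (phi \o sv_proj V true)%VF.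
  by apply/lfunP=> v; rewrite add_lfunE !comp_lfunE -linearD sv_proj_add.
by rewrite memv_add ?dual_part_proj.
Qed.

Fact dual_cap : (dual_part false :&: dual_part true)%VS = 0%VS.
Proof.
apply/eqP; rewrite -subv0; apply/subvP=> phi /memv_capP[/dual_partP p0 /dual_partP p1].
rewrite memv0; apply/eqP/sv_eq => -[] v vp; rewrite zero_lfunE.
  exact: p0.
exact: p1.
Qed.

Definition sv_dual : svect F := SVect dual_add dual_cap.

(* The action on V^* of an operator u of parity p on V:
   (u phi)(v) = - (-1)^(p |phi|) phi (u v).
   The sign is encoded by phi \o sv_sign V = (-1)^|phi| phi; see [dual_opE]. *)
Definition dual_op (p : bool) (u : 'End(V)) : 'End(sv_dual) :=
  linfun (fun phi : 'Hom(V, F^o) => - (phi \o (if p then sv_sign V else \1) \o u)%VF).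

Lemma dual_opE' p u (phi : sv_dual) :
  dual_op p u phi = (- (phi \o (if p then sv_sign V else \1) \o u))%VF.
Proof.
apply: (@linfunE F 'Hom(V, F^o)) => a f g; apply/lfunP=> v.
by rewrite !(opp_lfunE, comp_lfunE, add_lfunE, scale_lfunE) opprD scalerN.
Qed.

Lemma dual_op0 u (phi : sv_dual) v : dual_op false u phi v = - phi (u v).
Proof. by rewrite dual_opE' opp_lfunE !comp_lfunE id_lfunE. Qed.

Lemma dual_op1 u (phi : sv_dual) v : dual_op true u phi v = - phi (sv_sign V (u v)).
Proof. by rewrite dual_opE' opp_lfunE !comp_lfunE. Qed.

Lemma dual_opE (p q : bool) u (phi : sv_dual) v : phi \in sv_part sv_dual q ->
  dual_op p u phi v = - (-1) ^+ (p && q) * phi (u v).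
Proof.
case: p => phq; last by rewrite dual_op0 expr0 mulN1r.
rewrite dual_op1 mulNr; congr (- _); rewrite -[u v]sv_proj_add !linearD /=.
move: phq => /dual_partP phq.
rewrite !(sv_signE (sv_projP _ _)) !linearZ /= mulrDr expr0 expr1.
case: q phq => /= phq.
  by rewrite [phi (sv_proj V false _)]phq ?sv_projP // scaler0 mulr0.
by rewrite [phi (sv_proj V true _)]phq ?sv_projP // scaler0 mulr0 scale1r mul1r.
Qed.

Lemma dual_op0_even u : even_map u -> even_map (dual_op false u).
Proof.
move=> eu p; apply/stableP => phi /dual_partP ph; apply/dual_partP=> v vp.
by rewrite dual_op0 ph ?oppr0 //; apply/(stableP u) => //; exact: eu.
Qed.

Lemma dual_op1_odd u : odd_map u -> odd_map (dual_op true u).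
Proof.
move=> ou p; apply/stableP => phi /dual_partP ph; apply/dual_partP=> v vp.
have uv : u v \in sv_part V (~~ p).
  by move: vp; rewrite negbK => /((stableP _ _ _ (ou p)) v).
by rewrite dual_op1 (sv_signE uv) linearZ /= ph // scaler0 oppr0.
Qed.

End Dual.

Lemma even_opp (F : fieldType) (V W : svect F) (f : 'Hom(V, W)) : even_map f -> even_map (- f).
Proof.
by move=> ef p; apply/stableP=> v vp; rewrite opp_lfunE memvN; apply/(stableP f): v vp; exact: ef.
Qed.

Lemma odd_opp (F : fieldType) (V W : svect F) (f : 'Hom(V, W)) : odd_map f -> odd_map (- f).
Proof.
by move=> ef p; apply/stableP=> v vp; rewrite opp_lfunE memvN; apply/(stableP f): v vp; exact: ef.
Qed.

Section DualSemisimple.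
Variables (F : fieldType) (V : svect F).

Let ann (U : {vspace 'Hom(V, F^o)}) : {vspace V} :=
  (\bigcap_(i < \dim U) lker (vbasis U)`_i)%VS.

Let annP (U : {vspace 'Hom(V, F^o)}) v :
  reflect (forall phi, phi \in U -> phi v = 0) (v \in ann U).
Proof.
apply: (iffP idP) => [vU phi phU|vU].
  rewrite (coord_vbasis phU) sum_lfunE big1 // => i _.
  rewrite scale_lfunE; suff -> : (vbasis U)`_i v = 0 by rewrite scaler0.
  apply/eqP; rewrite -memv_ker; move: v vU; apply/subvP.
  by rewrite /ann (bigD1 i) //= capvSl.
rewrite memvE; apply/subv_bigcapP=> i _; rewrite -memvE memv_ker vU //.
by rewrite vbasis_mem // mem_nth // size_tuple.
Qed.

Let biann (U : {vspace 'Hom(V, F^o)}) (psi : 'Hom(V, F^o)) :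
  (forall v, v \in ann U -> psi v = 0) -> psi \in U.
Proof.
move=> psi0; pose n := \dim U.
have linPhi : linear (fun v : V => \row_(i < n) ((vbasis U)`_i v : F)).
  by move=> a u v; apply/rowP=> i; rewrite !mxE linearP.
pose Phi : 'Hom(V, 'rV[F]_n) := linfun (fun v : V => \row_(i < n) ((vbasis U)`_i v : F)).
have PhiE v : Phi v = \row_(i < n) ((vbasis U)`_i v : F) by rewrite linfunE.
pose g : 'Hom('rV[F]_n, F^o) := (psi \o Phi^-1)%VF.
have gP v : psi v = g (Phi v).
  rewrite comp_lfunE; apply/eqP; rewrite -subr_eq0 -linearB; apply/eqP/psi0.
  apply/annP=> phi phU; rewrite (coord_vbasis phU) sum_lfunE big1 // => i _.
  rewrite scale_lfunE linearB /=.
  have : Phi (Phi^-1%VF (Phi v)) = Phi v by rewrite limg_lfunVK // memv_img ?memvf.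
  by set w := (Phi^-1)%VF _; rewrite !PhiE => /rowP/(_ i); rewrite !mxE => ->; rewrite subrr scaler0.
have -> : psi = \sum_(i < n) g (delta_mx 0 i) *: (vbasis U)`_i.
  apply/lfunP=> v; rewrite gP [Phi v]row_sum_delta sum_lfunE linear_sum.
  apply: eq_bigr => i _; rewrite linearZ /= scale_lfunE PhiE mxE.
  by rewrite [_ *: _]mulrC.
by apply: memv_suml => i _; rewrite memvZ // vbasis_mem // mem_nth // size_tuple.
Qed.

Lemma semisimple_dual (u : 'End(V)) : semisimple u -> semisimple (- dual_op false u).
Proof.
have duE (phi : sv_dual V) v : (- dual_op false u)%R phi v = phi (u v).
  by rewrite !opp_lfunE dual_op0 opprK.
move=> ssu U /stableP uU.
have [|W [/stableP uW sW cW]] := ssu (ann U).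
  apply/stableP=> v /annP vU; apply/annP=> phi phU.
  by rewrite -duE vU // uU.
pose PW := linfun (fun phi : 'Hom(V, F^o) => (phi \o projv W)%VF).
have PWE phi : PW phi = (phi \o projv W)%VF.
  by rewrite linfunE // => a f g; rewrite comp_lfunDl -comp_lfunZl.
have PWP (phi : 'Hom(V, F^o)) : reflect (forall v, v \in W -> phi v = 0) (phi \in lker PW).
  rewrite memv_ker PWE; apply: (iffP eqP) => [/lfunP e v vW|e].
    by have := e v; rewrite comp_lfunE zero_lfunE projv_id.
  by apply/lfunP=> v; rewrite comp_lfunE zero_lfunE e // memv_proj.
exists (lker PW); split.
- apply/stableP=> phi /PWP phW; apply/PWP=> v vW.
  by rewrite duE phW ?uW.
- apply/eqP; rewrite eqEsubv subvf; apply/subvP=> phi _.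
  have -> : phi = (phi \o daddv_pi W (ann U))%VF + (phi \o daddv_pi (ann U) W)%VF.
    apply/lfunP=> v; rewrite add_lfunE !comp_lfunE -linearD addrC daddv_pi_add //.
    by rewrite sW memvf.
  have pi0 (A B : {vspace V}) v : (A :&: B)%VS = 0%VS -> (A + B)%VS = fullv ->
      v \in B -> daddv_pi A B v = 0.
    move=> cAB sAB vB; have : v \in (A + B)%VS by rewrite sAB memvf.
    move=> /(daddv_pi_add cAB); rewrite [daddv_pi B A v]daddv_pi_id ?[(B :&: A)%VS]capvC //.
    by move/eqP; rewrite -subr_eq0 addrK => /eqP.
  apply: memv_add.
    apply: biann => v vU; rewrite comp_lfunE pi0 ?linear0 //.
      by rewrite capvC.
    by rewrite addvC.
  by apply/PWP=> v vW; rewrite comp_lfunE pi0 ?linear0.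
apply/eqP; rewrite -subv0; apply/subvP=> phi /memv_capP[phU /PWP phW].
rewrite memv0; apply/eqP/lfunP=> v; rewrite zero_lfunE.
have : v \in (ann U + W)%VS by rewrite sW memvf.
move=> /memv_addP[a /annP aU [w wW ->]].
by rewrite linearD /= aU // phW // addr0.
Qed.

End DualSemisimple.

Record gmRep (F : fieldType) := GmRep {
  gm_space :> svect F;
  gm_h : 'End(gm_space);
  gm_h_even : even_map gm_h;
  gm_h_ss : semisimple gm_h }.

Record gmHom (F : fieldType) (N N' : gmRep F) := GmHom {
  gm_fun :> 'Hom(N, N');
  gm_fun_even : even_map gm_fun;
  gm_fun_h : forall v, gm_fun (gm_h N v) = gm_h N' (gm_fun v) }.

Definition gm_iso (F : fieldType) (N N' : gmRep F) (f : gmHom N N') : Prop :=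
  exists g : gmHom N' N, cancel f g /\ cancel g f.

Record glRep (F : fieldType) := GlRep {
  gl_space :> svect F;
  gl_h : 'End(gl_space);
  gl_c : 'End(gl_space);
  gl_x : 'End(gl_space);
  gl_y : 'End(gl_space);
  gl_h_even : even_map gl_h;
  gl_c_even : even_map gl_c;
  gl_x_odd : odd_map gl_x;
  gl_y_odd : odd_map gl_y;
  gl_ch : forall v, gl_c (gl_h v) - gl_h (gl_c v) = 0;
  gl_cx : forall v, gl_c (gl_x v) - gl_x (gl_c v) = 0;
  gl_cy : forall v, gl_c (gl_y v) - gl_y (gl_c v) = 0;
  gl_hx : forall v, gl_h (gl_x v) - gl_x (gl_h v) = gl_x v;
  gl_hy : forall v, gl_h (gl_y v) - gl_y (gl_h v) = - gl_y v;
  gl_xy : forall v, gl_x (gl_y v) + gl_y (gl_x v) = gl_c v;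
  gl_xx : forall v, gl_x (gl_x v) + gl_x (gl_x v) = 0;
  gl_yy : forall v, gl_y (gl_y v) + gl_y (gl_y v) = 0;
  gl_h_ss : semisimple gl_h;
  gl_c_ss : semisimple gl_c }.

Record glHom (F : fieldType) (M N : glRep F) := GlHom {
  gl_fun :> 'Hom(M, N);
  gl_fun_even : even_map gl_fun;
  gl_fun_h : forall v, gl_fun (gl_h M v) = gl_h N (gl_fun v);
  gl_fun_c : forall v, gl_fun (gl_c M v) = gl_c N (gl_fun v);
  gl_fun_x : forall v, gl_fun (gl_x M v) = gl_x N (gl_fun v);
  gl_fun_y : forall v, gl_fun (gl_y M v) = gl_y N (gl_fun v) }.

Definition dual_map (F : fieldType) (V W : svect F) (f : 'Hom(V, W)) :
    'Hom(sv_dual W, sv_dual V) :=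
  linfun (fun phi : 'Hom(W, F^o) => (phi \o f)%VF).

Lemma dual_mapE (F : fieldType) (V W : svect F) (f : 'Hom(V, W))
    (phi : sv_dual W) : dual_map f phi = (phi \o f)%VF.
Proof.
by apply: (@linfunE F 'Hom(W, F^o)) => a u v; rewrite comp_lfunDl -comp_lfunZl.
Qed.

Lemma dual_map_even (F : fieldType) (V W : svect F) (f : 'Hom(V, W)) :
  even_map f -> even_map (dual_map f).
Proof.
move=> ef p; apply/stableP=> phi /dual_partP ph; apply/dual_partP=> v vp.
by rewrite dual_mapE comp_lfunE ph //; apply/(stableP f) => //; exact: ef.
Qed.

Section GmDual.
Variable F : fieldType.

Definition gm_dual (N : gmRep F) : gmRep F :=
  GmRep (even_opp (dual_op0_even (@gm_h_even F N))) (semisimple_dual (@gm_h_ss F N)).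

Lemma gm_dual_hE (N : gmRep F) (phi : gm_dual N) v :
  gm_h (gm_dual N) phi v = phi (gm_h N v).
Proof. by rewrite /= !opp_lfunE dual_op0 opprK. Qed.

Fact gm_dual_map_h (N N' : gmRep F) (f : gmHom N N') phi :
  dual_map f (gm_h (gm_dual N') phi) = gm_h (gm_dual N) (dual_map f phi).
Proof.
apply/lfunP=> v; rewrite gm_dual_hE !dual_mapE !comp_lfunE gm_dual_hE.
by rewrite gm_fun_h.
Qed.

Definition gm_dual_map (N N' : gmRep F) (f : gmHom N N') :
    gmHom (gm_dual N') (gm_dual N) :=
  @GmHom F (gm_dual N') (gm_dual N) _
    (dual_map_even (@gm_fun_even _ _ _ f)) (gm_dual_map_h f).

End GmDual.

Section GlDual.
Variables (F : fieldType) (M : glRep F).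

(* u acts on the contragredient dual as sigma(u) acts on the dual, with
   sigma(h) = -h, sigma(c) = -c, sigma(x) = -y, sigma(y) = x. *)
Definition dual_h : 'End(sv_dual M) := - dual_op false (gl_h M).
Definition dual_c : 'End(sv_dual M) := - dual_op false (gl_c M).
Definition dual_x : 'End(sv_dual M) := - dual_op true (gl_y M).
Definition dual_y : 'End(sv_dual M) := dual_op true (gl_x M).

Lemma dual_hE phi v : dual_h phi v = phi (gl_h M v).
Proof. by rewrite !opp_lfunE dual_op0 opprK. Qed.
Lemma dual_cE phi v : dual_c phi v = phi (gl_c M v).
Proof. by rewrite !opp_lfunE dual_op0 opprK. Qed.
Lemma dual_xE phi v : dual_x phi v = phi (sv_sign M (gl_y M v)).
Proof. by rewrite !opp_lfunE dual_op1 opprK. Qed.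
Lemma dual_yE phi v : dual_y phi v = - phi (sv_sign M (gl_x M v)).
Proof. exact: dual_op1. Qed.

#[local] Opaque dual_h dual_c dual_x dual_y.

Let addE (phi psi : sv_dual M) v : (phi + psi) v = phi v + psi v.
Proof. exact: add_lfunE. Qed.
Let oppE (phi : sv_dual M) v : (- phi) v = - phi v.
Proof. exact: opp_lfunE. Qed.
Let zeroE v : (0 : sv_dual M) v = 0.
Proof. exact: zero_lfunE. Qed.
Let lE := (addE, oppE, zeroE).
Let phiN (phi : sv_dual M) v : phi (- v) = - phi v.
Proof. exact: linearN. Qed.
Let phiD (phi : sv_dual M) v w : phi (v + w) = phi v + phi w.
Proof. exact: linearD. Qed.
Let phi0 (phi : sv_dual M) : phi 0 = 0.
Proof. exact: linear0. Qed.
Let sN v : sv_sign M (- v) = - sv_sign M v.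
Proof. exact: linearN. Qed.
Let dE := (dual_hE, dual_cE, dual_xE, dual_yE).

Let chC v : gl_c M (gl_h M v) = gl_h M (gl_c M v).
Proof. exact/subr0_eq/gl_ch. Qed.
Let cxC v : gl_c M (gl_x M v) = gl_x M (gl_c M v).
Proof. exact/subr0_eq/gl_cx. Qed.
Let cyC v : gl_c M (gl_y M v) = gl_y M (gl_c M v).
Proof. exact/subr0_eq/gl_cy. Qed.

Let hS v : gl_h M (sv_sign M v) = sv_sign M (gl_h M v).
Proof. exact/even_sign/gl_h_even. Qed.
Let cS v : gl_c M (sv_sign M v) = sv_sign M (gl_c M v).
Proof. exact/even_sign/gl_c_even. Qed.
Let xS v : gl_x M (sv_sign M v) = - sv_sign M (gl_x M v).
Proof. exact/odd_sign/gl_x_odd. Qed.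
Let yS v : gl_y M (sv_sign M v) = - sv_sign M (gl_y M v).
Proof. exact/odd_sign/gl_y_odd. Qed.

Fact dual_ch phi : dual_c (dual_h phi) - dual_h (dual_c phi) = 0.
Proof. by apply/lfunP=> v; rewrite !lE !dE chC subrr. Qed.
Fact dual_cx phi : dual_c (dual_x phi) - dual_x (dual_c phi) = 0.
Proof. by apply/lfunP=> v; rewrite !lE !dE cS cyC subrr. Qed.
Fact dual_cy phi : dual_c (dual_y phi) - dual_y (dual_c phi) = 0.
Proof. by apply/lfunP=> v; rewrite !lE !dE cS cxC subrr. Qed.
Fact dual_hx phi : dual_h (dual_x phi) - dual_x (dual_h phi) = dual_x phi.
Proof.
apply/lfunP=> v; rewrite !lE !dE hS -!linearB /= -opprB gl_hy.
by rewrite opprK.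
Qed.
Fact dual_hy phi : dual_h (dual_y phi) - dual_y (dual_h phi) = - dual_y phi.
Proof.
apply/lfunP=> v; rewrite !lE !dE hS !opprK addrC -!linearB /=.
by rewrite gl_hx.
Qed.
Fact dual_xy phi : dual_x (dual_y phi) + dual_y (dual_x phi) = dual_c phi.
Proof.
apply/lfunP=> v; rewrite !lE !dE -gl_xy phiD.
by rewrite xS yS !sN !sv_signK !phiN !opprK.
Qed.
Fact dual_xx phi : dual_x (dual_x phi) + dual_x (dual_x phi) = 0.
Proof.
apply/lfunP=> v; rewrite !lE !dE yS sN sv_signK phiN -opprD -phiD.
by rewrite gl_yy phi0 oppr0.
Qed.
Fact dual_yy phi : dual_y (dual_y phi) + dual_y (dual_y phi) = 0.
Proof.
apply/lfunP=> v; rewrite !lE !dE xS sN sv_signK phiN !opprK -opprD -phiD.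
by rewrite gl_xx phi0 oppr0.
Qed.

#[local] Transparent dual_h dual_c dual_x dual_y.

Definition gl_dual : glRep F :=
  @GlRep F (sv_dual M) dual_h dual_c dual_x dual_y
    (even_opp (dual_op0_even (@gl_h_even F M)))
    (even_opp (dual_op0_even (@gl_c_even F M)))
    (odd_opp (dual_op1_odd (@gl_y_odd F M)))
    (dual_op1_odd (@gl_x_odd F M))
    dual_ch dual_cx dual_cy dual_hx dual_hy dual_xy dual_xx dual_yy
    (semisimple_dual (@gl_h_ss F M)) (semisimple_dual (@gl_c_ss F M)).

End GlDual.

Section GlDualMap.
Variables (F : fieldType) (M N : glRep F) (f : glHom M N).

Let fS v : f (sv_sign M v) = sv_sign N (f v).
Proof. exact/even_sign/gl_fun_even. Qed.

Fact gl_dual_map_h phi : dual_map f (dual_h N phi) = dual_h M (dual_map f phi).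
Proof.
by apply/lfunP=> v; rewrite dual_hE !dual_mapE !comp_lfunE dual_hE gl_fun_h.
Qed.
Fact gl_dual_map_c phi : dual_map f (dual_c N phi) = dual_c M (dual_map f phi).
Proof.
by apply/lfunP=> v; rewrite dual_cE !dual_mapE !comp_lfunE dual_cE gl_fun_c.
Qed.
Fact gl_dual_map_x phi : dual_map f (dual_x N phi) = dual_x M (dual_map f phi).
Proof.
by apply/lfunP=> v; rewrite dual_xE !dual_mapE !comp_lfunE dual_xE fS gl_fun_y.
Qed.
Fact gl_dual_map_y phi : dual_map f (dual_y N phi) = dual_y M (dual_map f phi).
Proof.
by apply/lfunP=> v; rewrite dual_yE !dual_mapE !comp_lfunE dual_yE fS gl_fun_x.
Qed.

Definition gl_dual_map : glHom (gl_dual N) (gl_dual M) :=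
  @GlHom F (gl_dual N) (gl_dual M) _ (dual_map_even (@gl_fun_even _ _ _ f))
    gl_dual_map_h gl_dual_map_c gl_dual_map_x gl_dual_map_y.

End GlDualMap.

Variant natinf := Fin of nat | Infty.

(* The value that u eventually takes; u 0 if u is not eventually constant. *)
Definition stable_value (T : choiceType) (u : nat -> T) : T :=
  xget (u 0%N) [set s : T | exists N, forall r, (N <= r)%N -> u r = s]%classic.

(* The subspace with underlying set P; the zero space if P is not a subspace. *)
Definition vspace_of (F : fieldType) (V : vectType F) (P : set V) : {vspace V} :=
  xget 0%VS [set U : {vspace V} | forall v, v \in U <-> P v]%classic.

Section Chains.
Variables (F : fieldType) (V : vectType F) (c a b : 'End(V)).

(* (v 1, ..., v r) is an r-chain for DS_(a,b); only used for r >= 1. *)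
Definition chain (r : nat) (v : nat -> V) : Prop :=
  [/\ forall i, (1 <= i <= r)%N -> c (v i) = 0,
      forall i, (1 <= i < r)%N -> a (v i) = b (v i.+1)
    & a (v r) = 0].

Definition Zset (r : nat) : set V :=
  match r with
  | 0 => [set v | c v = 0]%classic
  | _ => [set z | exists2 v, chain r v & z = v r]%classic
  end.

Definition Bset (r : nat) : set V :=
  match r with
  | 0 => [set 0]%classic
  | 1 => [set z | exists2 u, c u = 0 & z = a u]%classic
  | r'.+1 => [set z | exists u w, [/\ c u = 0, chain r' w & z = a u + b (w 1%N)]]%classic
  end.

Definition DSZ (n : natinf) : {vspace V} :=
  match n with
  | Fin r => vspace_of (Zset r)
  | Infty => stable_value (fun r => vspace_of (Zset r))
  end.

Definition DSB (n : natinf) : {vspace V} :=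
  match n with
  | Fin r => vspace_of (Bset r)
  | Infty => stable_value (fun r => vspace_of (Bset r))
  end.

End Chains.

Lemma vspace_ofP (F : fieldType) (V : vectType F) (P : set V) :
  P 0 -> (forall k u v, P u -> P v -> P (k *: u + v)) ->
  forall v, v \in vspace_of P <-> P v.
Proof.
move=> P0 PD.
suff ex : exists U : {vspace V}, forall v, v \in U <-> P v.
  exact: (@xgetPex _ _ [set U : {vspace V} | forall v, v \in U <-> P v]%classic).
suff [U UP maxU] : exists2 U : {vspace V}, (forall v, v \in U -> P v) &
    forall v, P v -> v \in U.
  by exists U => v; split; [exact: UP | exact: maxU].
apply: contrapT => noU.
suff big k : exists2 U : {vspace V}, (forall v, v \in U -> P v) & (k <= \dim U)%N.
  have [U _] := big (\dim {:V}).+1.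
  by rewrite leqNgt ltnS dimvS ?subvf.
elim: k => [|k [U UP kU]]; first by exists 0%VS => // v; rewrite memv0 => /eqP ->.
have [v [Pv vU]] : exists v, P v /\ v \notin U.
  apply: contrapT => nv; apply: noU; exists U => // v Pv.
  by apply/negPn/negP => vU; apply: nv; exists v.
exists (<[v]> + U)%VS.
  by move=> _ /memv_addP[_ /vlineP[l ->] [u uU ->]]; apply: PD => //; exact: UP.
apply: leq_ltn_trans kU _; rewrite ltn_neqAle (dimv_leqif_eq (addvSr _ _)).1 andbT.
rewrite (dimv_leqif_eq (addvSr _ _)).2; apply: contra vU => /eqP ->.
by apply: (subvP (addvSl _ _)); exact: memv_line.
Qed.

Lemma nat_argmin (d : nat -> nat) : exists N, forall r, (d N <= d r)%N.
Proof.
suff H k : forall N, (d N <= k)%N -> exists N, forall r, (d N <= d r)%N by exact: H (d 0) 0%N _.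
elim: k => [|k IH] N dN.
  by exists N => r; apply: leq_trans dN _.
have [[r dr]|no] := pselect (exists r, (d r <= k)%N); first exact: IH dr.
exists N => r; apply: leq_trans dN _; rewrite ltnNge; apply/negP => dr.
by apply: no; exists r.
Qed.

Lemma stable_valueP (T : choiceType) (u : nat -> T) :
  (exists s N, forall r, (N <= r)%N -> u r = s) ->
  exists N, forall r, (N <= r)%N -> stable_value u = u r.
Proof.
move=> ex; have [N HN] : exists N, forall r, (N <= r)%N -> u r = stable_value u.
  exact: (@xgetPex _ _ [set s : T | exists N, forall r, (N <= r)%N -> u r = s]%classic).
by exists N => r /HN.
Qed.

Lemma stable_dec (F : fieldType) (V : vectType F) (u : nat -> {vspace V}) :
  (forall r, (u r.+1 <= u r)%VS) ->
  exists s N, forall r, (N <= r)%N -> u r = s.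
Proof.
move=> udec; have [N HN] := nat_argmin (fun r => \dim (u r)).
exists (u N), N => r Nr; apply/eqP; rewrite eqEdim HN andbT.
elim: r Nr => [|r IH]; first by rewrite leqn0 => /eqP ->; exact: subvv.
rewrite leq_eqVlt ltnS => /orP[/eqP ->|/IH]; first exact: subvv.
exact: subv_trans.
Qed.

Lemma stable_inc (F : fieldType) (V : vectType F) (u : nat -> {vspace V}) :
  (forall r, (u r <= u r.+1)%VS) ->
  exists s N, forall r, (N <= r)%N -> u r = s.
Proof.
move=> uinc; have [N HN] := nat_argmin (fun r => (\dim {:V} - \dim (u r))%N).
exists (u N), N => r Nr; apply/eqP; rewrite eq_sym eqEdim; apply/andP; split.
  elim: r Nr => [|r IH]; first by rewrite leqn0 => /eqP ->; exact: subvv.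
  rewrite leq_eqVlt ltnS => /orP[/eqP ->|/IH]; first exact: subvv.
  by move=> h; exact: subv_trans h (uinc _).
by have := HN r; rewrite leq_sub2lE // dimvS ?subvf.
Qed.

Section ChainTheory.
Variables (F : fieldType) (V : vectType F) (c a b : 'End(V)).

Lemma chain0 r : chain c a b r (fun=> 0).
Proof. by split=> [i _|i _|]; rewrite !linear0. Qed.

Lemma chainP k r v w : chain c a b r v -> chain c a b r w ->
  chain c a b r (fun i => k *: v i + w i).
Proof.
move=> [v1 v2 v3] [w1 w2 w3]; split=> [i ir|i ir|]; rewrite !linearP /=.
- by rewrite v1 // w1 // scaler0 addr0.
- by rewrite v2 // w2.
by rewrite v3 w3 scaler0 addr0.
Qed.

Lemma ZsetP r v : v \in vspace_of (Zset c a b r) <-> Zset c a b r v.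
Proof.
apply: vspace_ofP; case: r => [|r] /=.
- exact: linear0.
- by exists (fun=> 0) => //; exact: chain0.
- by move=> k u w u0 w0; rewrite linearP /= u0 w0 scaler0 addr0.
move=> k _ _ [v1 h1 ->] [v2 h2 ->]; exists (fun i => k *: v1 i + v2 i) => //.
exact: chainP.
Qed.

Lemma BsetP r v : v \in vspace_of (Bset c a b r) <-> Bset c a b r v.
Proof.
apply: vspace_ofP; case: r => [|[|r]] /=.
- by [].
- by exists 0; rewrite linear0.
- exists 0, (fun=> 0); rewrite !linear0 addr0; split=> //; exact: chain0.
- by move=> k _ _ -> ->; rewrite scaler0 addr0.
- move=> k _ _ [u u0 ->] [w w0 ->]; exists (k *: u + w); rewrite linearP //=.
  by rewrite u0 w0 scaler0 addr0.
move=> k _ _ [u [w [u0 hw ->]]] [u' [w' [u'0 hw' ->]]].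
exists (k *: u + u'), (fun i => k *: w i + w' i); split.
- by rewrite linearP /= u0 u'0 scaler0 addr0.
- exact: chainP.
by rewrite !linearP /= scalerDr addrACA.
Qed.

Lemma Z_dec r : (vspace_of (Zset c a b r.+1) <= vspace_of (Zset c a b r))%VS.
Proof.
apply/subvP=> z /ZsetP /= [v [v1 v2 v3] ->]; apply/ZsetP; case: r v1 v2 v3 => [|r] v1 v2 v3.
  exact: v1.
exists (fun i => v i.+1) => //; split=> [i /andP[i1 ir]|i /andP[i1 ir]|//].
  by rewrite v1 // ltnS.
by rewrite v2 // ltnS.
Qed.

Lemma B_inc r : (vspace_of (Bset c a b r) <= vspace_of (Bset c a b r.+1))%VS.
Proof.
apply/subvP=> z /BsetP zB; apply/BsetP; case: r zB => [|[|r]] /=.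
- by move=> ->; exists 0; rewrite linear0.
- move=> [u u0 ->]; exists u, (fun=> 0); rewrite linear0 addr0.
  by split=> //; exact: chain0.
move=> [u [w [u0 [w1 w2 w3] ->]]].
exists u, (fun i => if (i <= r.+1)%N then w i else 0); split=> //.
split=> [i /andP[i1 ir]|i /andP[i1 ir]|].
- by case: ifP => h; rewrite ?linear0 // w1 // i1.
- move: ir; rewrite ltnS => ir; rewrite ir; move: ir; rewrite leq_eqVlt => /orP[/eqP e|ir].
    by rewrite e ltnn linear0 w3.
  by rewrite ir w2 // i1.
by rewrite ltnn linear0.
Qed.

Definition trunc (n : natinf) (r : nat) : nat := if n is Fin m then m else r.

Lemma DS_stable (n : natinf) : exists N, forall r, (N <= r)%N ->
  DSZ c a b n = vspace_of (Zset c a b (trunc n r)) /\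
  DSB c a b n = vspace_of (Bset c a b (trunc n r)).
Proof.
case: n => [m|]; first by exists 0%N.
have [N1 H1] := stable_valueP (stable_dec Z_dec).
have [N2 H2] := stable_valueP (stable_inc B_inc).
by exists (maxn N1 N2) => r; rewrite geq_max => /andP[r1 r2]; split; [exact: H1|exact: H2].
Qed.

End ChainTheory.

Section DSFunctor.
Variable F : fieldType.
Implicit Types (M N : glRep F) (a : bool).

(* x for false, y for true *)
Definition odd_op M (a : bool) : 'End(M) := if a then gl_y M else gl_x M.

Lemma odd_op_odd M a : odd_map (odd_op M a).
Proof. by case: a; [exact: gl_y_odd|exact: gl_x_odd]. Qed.

Lemma odd_opc M a v : gl_c M (odd_op M a v) = odd_op M a (gl_c M v).
Proof. by case: a; apply/subr0_eq; [exact: gl_cy|exact: gl_cx]. Qed.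

Lemma gl_chC M v : gl_c M (gl_h M v) = gl_h M (gl_c M v).
Proof. exact/subr0_eq/gl_ch. Qed.

Lemma odd_oph M a v :
  odd_op M a (gl_h M v) = gl_h M (odd_op M a v) - (-1) ^+ a *: odd_op M a v.
Proof.
have e : gl_h M (odd_op M a v) - odd_op M a (gl_h M v) = (-1) ^+ a *: odd_op M a v.
  by case: a; rewrite ?gl_hy ?gl_hx ?expr0 ?expr1 ?scale1r ?scaleN1r.
by rewrite -e opprB addrC subrK.
Qed.

Lemma odd_opT M a v : odd_op M a (odd_op M (~~ a) v) + odd_op M (~~ a) (odd_op M a v) = gl_c M v.
Proof. by case: a; rewrite ?gl_xy //= addrC gl_xy. Qed.

Lemma odd_op2 M a v : (2%:R : F) != 0 -> odd_op M a (odd_op M a v) = 0.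
Proof.
move=> n2; have : 2%:R *: odd_op M a (odd_op M a v) = 0.
  by rewrite scaler_nat mulr2n; case: a; [exact: gl_yy|exact: gl_xx].
by move/eqP; rewrite scaler_eq0 (negPf n2) => /eqP.
Qed.

Section Objects.
Variables (M : glRep F) (a : bool).
Let c := gl_c M.
Let A := odd_op M a.
Let B := odd_op M (~~ a).
Let h := gl_h M.
Let s : F := (-1) ^+ a.

Let Ah v : A (h v) = h (A v) - s *: A v.
Proof. exact: odd_oph. Qed.
Let Bh v : B (h v) = h (B v) + s *: B v.
Proof. by rewrite /B odd_oph signrN scaleNr opprK. Qed.

Let chain_h k r v : chain c A B r v ->
  chain c A B r (fun i => h (v i) + (k - s *+ (2 * i)) *: v i).
Proof.
move=> [v1 v2 v3]; split=> [i ir|i ir|].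
- by rewrite linearD linearZ /= /c gl_chC v1 // linear0 scaler0 addr0.
- rewrite !linearD !linearZ /= Ah Bh v2 //; rewrite -!addrA; congr (_ + _).
  rewrite -scaleNr -!scalerDl; congr (_ *: _).
  rewrite (mulnS 2 i) (mulrnDr s 2) mulr2n addrCA [RHS]addrCA; congr (_ + _).
  by rewrite !opprD !addrA subrr sub0r.
by rewrite linearD linearZ /= Ah v3 linear0 !scaler0 subr0 addr0.
Qed.

Let chain_proj p r v : chain c A B r v ->
  chain c A B r (fun i => sv_proj M p (v i)).
Proof.
have Ap w := odd_proj p w (odd_op_odd M a).
have Bp w := odd_proj p w (odd_op_odd M (~~ a)).
have cp w := even_proj p w (@gl_c_even F M).
move=> [v1 v2 v3]; split=> [i ir|i ir|].
- by rewrite /c cp v1 ?linear0.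
- by rewrite /A /B Ap Bp v2.
by rewrite /A Ap v3 linear0.
Qed.

Variable n : natinf.

Lemma DSZ_h z : z \in DSZ c A B n -> h z \in DSZ c A B n.
Proof.
have [r /(_ _ (leqnn r)) [-> _]] := DS_stable c A B n.
move: (trunc n r) => {}r /ZsetP zZ; apply/ZsetP; case: r zZ => [|r] /=.
  by rewrite /c gl_chC => ->; rewrite linear0.
move=> [v /(chain_h (s *+ (2 * r.+1))) hv ->].
by exists (fun i => h (v i) + (s *+ (2 * r.+1) - s *+ (2 * i)) *: v i) => //; rewrite subrr scale0r addr0.
Qed.

Lemma DSB_h z : z \in DSB c A B n -> h z \in DSB c A B n.
Proof.
have hA v : h (A v) = A (h v + s *: v) by rewrite linearD linearZ /= Ah subrK.
have hB v : h (B v) = B (h v - s *: v) by rewrite linearB linearZ /= Bh addrK.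
have [r /(_ _ (leqnn r)) [_ ->]] := DS_stable c A B n.
move: (trunc n r) => {}r /BsetP zB; apply/BsetP; case: r zB => [|[|r]] /=.
- by move=> ->; rewrite linear0.
- move=> [u u0 ->]; exists (h u + s *: u) => //.
  by rewrite linearD linearZ /= /c gl_chC u0 linear0 scaler0 addr0.
move=> [u [w [u0 /(chain_h s) hw ->]]].
exists (h u + s *: u), (fun i => h (w i) + (s - s *+ (2 * i)) *: w i); split=> //.
  by rewrite linearD linearZ /= /c gl_chC u0 linear0 scaler0 addr0.
by rewrite linearD /= hA hB muln1 mulr2n opprD addrA subrr sub0r scaleNr.
Qed.

Lemma DSZ_proj p z : z \in DSZ c A B n -> sv_proj M p z \in DSZ c A B n.
Proof.
have [r /(_ _ (leqnn r)) [-> _]] := DS_stable c A B n.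
move: (trunc n r) => {}r /ZsetP zZ; apply/ZsetP; case: r zZ => [|r] /=.
  by rewrite /c even_proj; [move=> ->; rewrite linear0 | exact: gl_c_even].
move=> [v /(chain_proj p) hv ->].
by exists (fun i => sv_proj M p (v i)).
Qed.

Lemma DSB_proj p z : z \in DSB c A B n -> sv_proj M p z \in DSB c A B n.
Proof.
have cp q w := even_proj q w (@gl_c_even F M).
have pA v : sv_proj M p (A v) = A (sv_proj M (~~ p) v).
  by rewrite /A odd_proj ?negbK //; exact: odd_op_odd.
have pB v : sv_proj M p (B v) = B (sv_proj M (~~ p) v).
  by rewrite /B odd_proj ?negbK //; exact: odd_op_odd.
have [r /(_ _ (leqnn r)) [_ ->]] := DS_stable c A B n.
move: (trunc n r) => {}r /BsetP zB; apply/BsetP; case: r zB => [|[|r]] /=.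
- by move=> ->; rewrite linear0.
- move=> [u u0 ->]; exists (sv_proj M (~~ p) u) => //.
  by rewrite /c cp u0 linear0.
move=> [u [w [u0 /(chain_proj (~~ p)) hw ->]]].
exists (sv_proj M (~~ p) u), (fun i => sv_proj M (~~ p) (w i)); split=> //.
  by rewrite /c cp u0 linear0.
by rewrite linearD /= pA pB.
Qed.

Lemma DSB_sub_DSZ : (2%:R : F) != 0 -> (DSB c A B n <= DSZ c A B n)%VS.
Proof.
move=> n2; have AA v : A (A v) = 0 by exact: odd_op2.
have BB v : B (B v) = 0 by exact: odd_op2.
have AB v : c v = 0 -> B (A v) = - A (B v).
  by move=> cv; apply/eqP; rewrite -addr_eq0 addrC odd_opT -/c cv.
have cA v : c v = 0 -> c (A v) = 0 by move=> cv; rewrite /c odd_opc -/c cv linear0.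
have cB v : c v = 0 -> c (B v) = 0 by move=> cv; rewrite /c odd_opc -/c cv linear0.
have [r /(_ _ (leqnn r)) [-> ->]] := DS_stable c A B n.
move: (trunc n r) => {}r; apply/subvP=> z /BsetP zB; apply/ZsetP.
have main r' u t : c u = 0 -> c t = 0 -> A (B t) = 0 -> Zset c A B r'.+1 (A u + B t).
  move=> u0 t0 ABt.
  exists (fun i => if i == r'.+1 then A u + B t else if i == r' then - B u else 0); last by rewrite eqxx.
  split=> [i _|i /andP[_ ir]|]; last by rewrite eqxx linearD /= AA ABt addr0.
    case: ifP => _; first by rewrite linearD /= cA // cB // addr0.
    by case: ifP => _; rewrite ?linear0 // linearN /= cB // oppr0.
  rewrite (ltn_eqF ir) eqSS; case: (i =P r') => [ir'|_].
    by rewrite linearD linearN /= BB addr0 AB.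
  by rewrite linear0; case: ifP => _; rewrite ?linear0 // linearN /= BB oppr0.
case: r zB => [|[|r]].
- by move=> ->; rewrite /= linear0.
- by move=> [u u0 ->]; rewrite -[A u]addr0 -(linear0 B); apply: main; rewrite ?linear0.
move=> [u [w [u0 [w1 w2 w3] ->]]]; apply: main => //; first exact: w1.
apply/eqP; rewrite -oppr_eq0 -AB ?w1 //; case: r w1 w2 w3 => [|r] _ w2 w3.
  by rewrite w3 linear0.
by rewrite w2 // BB.
Qed.

Fact DS_h_even : even_map (V := sv_subquot DSZ_proj DSB_proj) (W := sv_subquot DSZ_proj DSB_proj)
  (sq_map (DSZ c A B n) (DSB c A B n) (DSZ c A B n) (DSB c A B n) h).
Proof.
move=> p; apply/stableP=> q /sq_partP[z [zZ zp] ->].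
rewrite (sq_mapE DSZ_h DSB_h) //; apply: sq_part_pi; first exact: DSZ_h.
exact: (stableP _ _ _ (@gl_h_even F M p)).
Qed.

Definition DS : gmRep F :=
  @GmRep F (sv_subquot DSZ_proj DSB_proj) _ DS_h_even
    (semisimple_subquot DSZ_h DSB_h (@gl_h_ss F M)).

End Objects.

Section Morphisms.
Variables (M N : glRep F) (f : glHom M N) (a : bool) (n : natinf).
Let ZM := DSZ (gl_c M) (odd_op M a) (odd_op M (~~ a)) n.
Let BM := DSB (gl_c M) (odd_op M a) (odd_op M (~~ a)) n.
Let ZN := DSZ (gl_c N) (odd_op N a) (odd_op N (~~ a)) n.
Let BN := DSB (gl_c N) (odd_op N a) (odd_op N (~~ a)) n.

Let fA e v : f (odd_op M e v) = odd_op N e (f v).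
Proof. by case: e; [exact: gl_fun_y|exact: gl_fun_x]. Qed.
Let fc v : f (gl_c M v) = gl_c N (f v).
Proof. exact: gl_fun_c. Qed.

Let chain_f r v : chain (gl_c M) (odd_op M a) (odd_op M (~~ a)) r v ->
  chain (gl_c N) (odd_op N a) (odd_op N (~~ a)) r (fun i => f (v i)).
Proof.
move=> [v1 v2 v3]; split=> [i ir|i ir|].
- by rewrite -fc v1 ?linear0.
- by rewrite -!fA v2.
by rewrite -fA v3 linear0.
Qed.

Let common : exists r, [/\ ZM = vspace_of (Zset (gl_c M) (odd_op M a) (odd_op M (~~ a)) r),
  BM = vspace_of (Bset (gl_c M) (odd_op M a) (odd_op M (~~ a)) r),
  ZN = vspace_of (Zset (gl_c N) (odd_op N a) (odd_op N (~~ a)) r) &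
  BN = vspace_of (Bset (gl_c N) (odd_op N a) (odd_op N (~~ a)) r)].
Proof.
have [r1 H1] := DS_stable (gl_c M) (odd_op M a) (odd_op M (~~ a)) n.
have [r2 H2] := DS_stable (gl_c N) (odd_op N a) (odd_op N (~~ a)) n.
exists (trunc n (maxn r1 r2)).
by have [] := H1 _ (leq_maxl r1 r2); have [] := H2 _ (leq_maxr r1 r2).
Qed.

Lemma DSZ_f z : z \in ZM -> f z \in ZN.
Proof.
have [r [-> _ -> _]] := common => /ZsetP zZ; apply/ZsetP; case: r zZ => [|r] /=.
  by rewrite -fc => ->; rewrite linear0.
by move=> [v /chain_f hv ->]; exists (fun i => f (v i)).
Qed.

Lemma DSB_f z : z \in BM -> f z \in BN.
Proof.
have [r [_ -> _ ->]] := common => /BsetP zB; apply/BsetP; case: r zB => [|[|r]] /=.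
- by move=> ->; rewrite linear0.
- by move=> [u u0 ->]; exists (f u); rewrite -?fc ?u0 ?linear0.
move=> [u [w [u0 /chain_f hw ->]]]; exists (f u), (fun i => f (w i)); split=> //.
  by rewrite -fc u0 linear0.
by rewrite linearD /= !fA.
Qed.

Fact DS_map_even : even_map (V := DS M a n) (W := DS N a n) (sq_map ZM BM ZN BN f).
Proof.
move=> p; apply/stableP=> q /sq_partP[z [zZ zp] ->].
rewrite (sq_mapE DSZ_f DSB_f) //; apply: sq_part_pi; first exact: DSZ_f.
exact: (stableP _ _ _ (@gl_fun_even F M N f p)).
Qed.

Fact DS_map_h q :
  sq_map ZM BM ZN BN f (gm_h (DS M a n) q) = gm_h (DS N a n) (sq_map ZM BM ZN BN f q).
Proof.
rewrite -[q]sq_reprK; have zZ := sq_reprZ q; move: (sq_repr q) zZ => z zZ.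
rewrite (sq_mapE (@DSZ_h M a n) (@DSB_h M a n)) // !(sq_mapE DSZ_f DSB_f) //; last exact: DSZ_h.
by rewrite (sq_mapE (@DSZ_h N a n) (@DSB_h N a n)) ?DSZ_f // gl_fun_h.
Qed.

Definition DS_map : gmHom (DS M a n) (DS N a n) :=
  @GmHom F (DS M a n) (DS N a n) _ DS_map_even DS_map_h.

End Morphisms.

End DSFunctor.

Definition DS_yx (F : fieldType) (n : natinf) (M : glRep F) : gmRep F := DS M true n.
Definition DS_xy (F : fieldType) (n : natinf) (M : glRep F) : gmRep F := DS M false n.

Definition DS_yx_map (F : fieldType) (n : natinf) (M N : glRep F) (f : glHom M N) :
  gmHom (DS_yx n M) (DS_yx n N) := DS_map f true n.
Definition DS_xy_map (F : fieldType) (n : natinf) (M N : glRep F) (f : glHom M N) :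
  gmHom (DS_xy n M) (DS_xy n N) := DS_map f false n.

(* Main.v *)
Require Import Defs.
From mathcomp Require Import all_boot all_order all_algebra reals complex.

(* The isomorphism is evaluation, [phi] |-> ([v] |-> [phi v]).  Since c is
   semisimple, V = ker c (+) im c, so functionals killing im c are functionals on
   V^c = ker c.  Among these, Z_n of the dual is the annihilator of B_n(V), and B_n
   of the dual is the annihilator of Z_n(V): the n-chains form the kernel of the map
   v |-> (y v_i - x v_(i+1))_i on n-tuples, a functional killing this kernel factors
   through the map, and the components of the factor are, up to signs and the parity
   involution, a chain in the dual read backwards.  Hence Z_n / B_n of the dual is
   B_n(V)^perp / Z_n(V)^perp = (Z_n(V) / B_n(V))^*. *)

Set Implicit Arguments.
Unset Strict Implicit.
Unset Printing Implicit Defensive.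

Import GRing.Theory Num.Theory.
Local Open Scope ring_scope.

(** * Functionals that factor through a linear map, and zigzag relations *)

Section Factor.
Variables (F : fieldType) (V W : vectType F).

(** The pseudo-inverse of [K] is a section on its image, so [v] and [K^-1 (K v)] differ by an
    element of the kernel, which [psi] kills. *)
Lemma lfun_factor (K : 'Hom(V, W)) (psi : 'Hom(V, F^o)) :
  (forall v, K v = 0 -> psi v = 0) ->
  exists mu : 'Hom(W, F^o), forall v, psi v = mu (K v).
Proof.
move=> psi0; exists (psi \o K^-1)%VF => v; rewrite comp_lfunE.
apply/eqP; rewrite -subr_eq0 -linearB; apply/eqP/psi0.
by rewrite linearB /= limg_lfunVK ?subrr // memv_img ?memvf.
Qed.

End Factor.

Section Zigzag.
Variables (F : fieldType) (V : vectType F) (A B : 'End(V)).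

(* [v r = 0] makes the condition [A (v r.-1) = 0] ending a chain an
   instance of the general relation; likewise [mu 0 = 0] at the other end. *)
Lemma zigzag_dual r (lam : nat -> 'Hom(V, F^o)) :
  (forall v : nat -> V, (forall i, (i < r)%N -> A (v i) = B (v i.+1)) -> v r = 0 ->
     \sum_(i < r) lam i (v i) = 0) ->
  exists2 mu : nat -> 'Hom(V, F^o), mu 0%N = 0 &
    forall i u, (i < r)%N -> lam i u = mu i.+1 (A u) - mu i (B u).
Proof.
move=> lam0.
pose X : vectType F := {ffun 'I_r -> V}.
(* Extension by zero supplies the entry at index [r] that the last relation needs. *)
pose ext (g : X) i : V := if insub i is Some j then g j else 0.
have extE g (i : 'I_r) : ext g i = g i by rewrite /ext valK.
have ext_ge g i : (r <= i)%N -> ext g i = 0.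
  by move=> ri; rewrite /ext insubF // ltnNge ri.
have extL k g g' i : ext (k *: g + g') i = k *: ext g i + ext g' i.
  by rewrite /ext; case: insubP => [j _ _|_]; rewrite ?ffunE // scaler0 addr0.
pose K0 (g : X) : X := [ffun i : 'I_r => A (g i) - B (ext g i.+1)].
have linK : linear K0.
  move=> k g g'; apply/ffunP=> i; rewrite !ffunE extL.
  rewrite [A _]linearP [B _]linearP.
  by rewrite scalerBr opprD addrACA.
pose psi0 (g : X) : F^o := \sum_(i < r) lam i (g i).
have linpsi : linear psi0.
  move=> k g g'; rewrite /psi0 scaler_sumr -big_split /=.
  by apply: eq_bigr => i _; rewrite !ffunE linearP.
have [|mu muE] := @lfun_factor F X X (linfun K0) (linfun psi0).
  move=> g; rewrite !linfunE // => /ffunP Kg.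
  transitivity (\sum_(i < r) lam i (ext g i)).
    by apply: eq_bigr => i _; rewrite extE.
  apply: lam0 => [i ir|]; last exact: ext_ge.
  have := Kg (Ordinal ir); rewrite !ffunE => /subr0_eq <-.
  by rewrite -(extE g (Ordinal ir)).
pose dl (i : nat) (w : V) : X := [ffun k : 'I_r => if k == i :> nat then w else 0].
have lindl i : linear (dl i).
  move=> k u w; apply/ffunP=> j; rewrite !ffunE.
  by case: ifP => _ //; rewrite scaler0 addr0.
have linmu i : linear (fun w => mu (dl i w)) by move=> k u w; rewrite lindl linearP.
(* Component [j] of the factor is named [mu j.+1], which leaves room for [mu 0 = 0]. *)
exists (fun i => if i is j.+1 then linfun (fun w => mu (dl j w)) else 0) => // i u ir.
rewrite linfunE //.
have <- : psi0 (dl i u) = lam i u.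
  rewrite /psi0 (bigD1 (Ordinal ir)) //= big1 ?addr0 ?ffunE ?eqxx // => j ji.
  by rewrite ffunE ifN ?linear0.
rewrite -(linfunE linpsi) muE linfunE //.
(* A vector in slot [i] enters relation [i] through [A] and, if [i > 0], relation [i.-1] through
   [- B]. *)
have -> : K0 (dl i u) = dl i (A u) - (if i is j.+1 then dl j (B u) else 0).
  apply/ffunP=> k; rewrite !ffunE; congr (_ - _).
    by case: ifP => _; rewrite ?linear0.
  rewrite /ext; case: insubP => [j _ jk|kr].
    rewrite ffunE jk; case: (i) => [|i'] /=; first by rewrite linear0 ffunE.
    by rewrite ffunE eqSS; case: ifP => _; rewrite ?linear0.
  case: (i) ir => [|i'] ir; first by rewrite linear0 ffunE.
  rewrite ffunE linear0 ifN //; apply: contraNneq kr => ->; exact: ir.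
rewrite linearB /=; congr (_ - _); case: (i) => [|j]; first by rewrite linear0 zero_lfunE.
by rewrite linfunE.
Qed.

End Zigzag.

(** * Splitting off the kernel of a semisimple operator *)

Section Fitting.
Variables (F : fieldType) (V : vectType F) (c : 'End(V)).
Hypothesis ssc : semisimple c.

(** On a [c]-stable complement [W] of the kernel, [c] is injective, hence onto [W] by dimension; [p]
    projects onto the kernel along [W]. *)
Lemma semisimple_ker_proj : exists p : 'End(V),
  [/\ forall v, c (p v) = 0, forall v, c v = 0 -> p v = v,
      forall v, p (c v) = 0 & forall v, exists t, v = p v + c t].
Proof.
have [|W [/stableP cW sW kW]] := ssc (U := lker c).
  by apply/stableP=> v; rewrite !memv_ker => /eqP ->; rewrite linear0.
have kW' : (W :&: lker c)%VS = 0%VS by rewrite capvC.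
have addE v : daddv_pi (lker c) W v + daddv_pi W (lker c) v = v.
  by apply: daddv_pi_add => //; rewrite sW memvf.
have cp v : c (daddv_pi (lker c) W v) = 0.
  by apply/eqP; rewrite -memv_ker memv_pi.
have pW v : v \in W -> daddv_pi (lker c) W v = 0.
  move=> vW; have := addE v; rewrite [daddv_pi W _ v]daddv_pi_id // => /eqP.
  by rewrite -subr_eq0 addrK => /eqP.
have imW : (c @: W)%VS = W.
  apply/eqP; rewrite eqEdim; apply/andP; split; first exact/stableP.
  by rewrite limg_dim_eq.
exists (daddv_pi (lker c) W); split=> [//|v cv|v|v].
- by apply: daddv_pi_id => //; rewrite memv_ker cv.
- by rewrite -[v]addE linearD /= cp add0r pW // cW // memv_pi.
have : daddv_pi W (lker c) v \in (c @: W)%VS by rewrite imW memv_pi.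
by move=> /memv_imgP[t _ et]; exists t; rewrite -et addE.
Qed.

End Fitting.

(** * Zigzags inside the kernel of [c] *)

Section ChainDual.
Variables (F : fieldType) (V : vectType F) (c A B : 'End(V)).
Hypothesis ssc : semisimple c.
Hypotheses (cA : forall v, c (A v) = A (c v)) (cB : forall v, c (B v) = B (c v)).

(** The projector [p] onto the kernel of [c] commutes with [A] and [B]. It turns zigzags into
    chains, and composing with it makes the [mu i] of [zigzag_dual] kill the image of [c]. *)
Lemma chain_dual r (lam : nat -> 'Hom(V, F^o)) :
  (forall i u, lam i (c u) = 0) ->
  (forall v, chain c A B r v -> \sum_(i < r) lam i (v i.+1) = 0) ->
  exists mu : nat -> 'Hom(V, F^o), [/\ mu 0%N = 0, forall i u, mu i (c u) = 0 &
    forall i u, (i < r)%N -> lam i u = mu i.+1 (A u) - mu i (B u)].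
Proof.
move=> lamc lam0; have [p [cp pid pc dec]] := semisimple_ker_proj ssc.
have pC (D : 'End(V)) : (forall v, c (D v) = D (c v)) -> forall v, p (D v) = D (p v).
  move=> cD v; have [t {1}->] := dec v.
  by rewrite linearD linearD /= -cD pc addr0 pid // cD cp linear0.
have lamp i u : lam i (p u) = lam i u.
  by have [t {2}->] := dec u; rewrite linearD /= lamc addr0.
have [|mu mu0 muE] := @zigzag_dual F V A B r lam.
  (* Zigzags are indexed from 0 and chains from 1, hence the shift. *)
  move=> v vAB vr; rewrite -[RHS](lam0 (fun i => p (v i.-1))).
    by apply: eq_bigr => i _; rewrite lamp.
  split=> [i _|[//|i] /andP[_ ir]|] //=.
    by rewrite -!pC // vAB // ltnW.
  case: (r) vAB vr => [|r'] vAB vr /=; first by rewrite vr !linear0.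
  by rewrite -pC // vAB // vr !linear0.
exists (fun i => (mu i \o p)%VF); split=> [|i u|i u ir].
- by rewrite mu0 comp_lfun0l.
- by rewrite comp_lfunE pc linear0.
by rewrite !comp_lfunE !pC // -muE // lamp.
Qed.

End ChainDual.

(** * Chains in the contragredient dual and annihilators *)

Section DualChains.
Variables (F : fieldType) (M : glRep F).

Let c := gl_c M.
Let A := gl_y M.
Let B := gl_x M.
Let s := sv_sign M.

Implicit Types (phi psi : sv_dual M) (v : M).

Let cA v : c (A v) = A (c v).
Proof. exact: (odd_opc true). Qed.
Let cB v : c (B v) = B (c v).
Proof. exact: (odd_opc false). Qed.
Let sc v : s (c v) = c (s v).
Proof. exact/esym/even_sign/gl_c_even. Qed.
Let sA v : s (A v) = - A (s v).
Proof. by apply: oppr_inj; rewrite opprK; exact/esym/odd_sign/gl_y_odd. Qed.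
Let sB v : s (B v) = - B (s v).
Proof. by apply: oppr_inj; rewrite opprK; exact/esym/odd_sign/gl_x_odd. Qed.

Lemma dual_c_eq0 phi : dual_c M phi = 0 <-> forall v, phi (c v) = 0.
Proof.
split=> [e v|e]; first by rewrite -dual_cE e zero_lfunE.
by apply/lfunP=> v; rewrite dual_cE e zero_lfunE.
Qed.

Lemma dual_x_eq0 phi : dual_x M phi = 0 <-> forall v, phi (A v) = 0.
Proof.
split=> [e v|e].
  have : dual_x M phi (s v) = 0 by rewrite e zero_lfunE.
  by rewrite dual_xE -/A -/s sA sv_signK linearN => /eqP; rewrite oppr_eq0 => /eqP.
by apply/lfunP=> v; rewrite dual_xE -/A -/s sA linearN /= e oppr0 zero_lfunE.
Qed.

(** Evaluation at [s v] removes the parity involution; the sign left over reflects [sigma(x) = -y]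
    against [sigma(y) = x]. *)
Lemma dual_xy_eq phi psi :
  dual_x M phi = dual_y M psi <-> forall v, phi (A v) = - psi (B v).
Proof.
split=> [e v|e].
  have : dual_x M phi (s v) = dual_y M psi (s v) by rewrite e.
  rewrite dual_xE dual_yE -/A -/B -/s sA sB !sv_signK !linearN /= opprK => <-.
  by rewrite opprK.
apply/lfunP=> v; rewrite dual_xE dual_yE -/A -/B -/s sA sB !linearN /= e.
by rewrite opprK.
Qed.

Lemma dual_chainP r (phi : nat -> sv_dual M) :
  chain (dual_c M) (dual_x M) (dual_y M) r phi <->
  [/\ forall i v, (1 <= i <= r)%N -> phi i (c v) = 0,
      forall i v, (1 <= i < r)%N -> phi i (A v) = - phi i.+1 (B v)
    & forall v, phi r (A v) = 0].
Proof.
split=> [[h1 h2 h3]|[h1 h2 h3]]; split.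
- by move=> i v ir; move/dual_c_eq0: (h1 i ir).
- by move=> i v ir; move/dual_xy_eq: (h2 i ir).
- by apply/dual_x_eq0.
- by move=> i ir; apply/dual_c_eq0 => v; rewrite h1.
- by move=> i ir; apply/dual_xy_eq => v; rewrite h2.
by apply/dual_x_eq0.
Qed.

Let Z := Zset c A B.
Let bd := Bset c A B.
Let Zd := Zset (dual_c M) (dual_x M) (dual_y M).
Let Bd := Bset (dual_c M) (dual_x M) (dual_y M).

Lemma Zset_c r v : Z r v -> c v = 0.
Proof. by case: r => [|r] //= [w [w1 _ _] ->]; rewrite w1 //= leqnn. Qed.

Lemma dual_Zset_c r phi : Zd r phi -> forall v, phi (c v) = 0.
Proof.
case: r => [|r] /=; first by move/dual_c_eq0.
by move=> [w /dual_chainP[w1 _ _] ->] v; rewrite w1 //= leqnn.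
Qed.

(** The two chains are traversed in opposite directions: [w i.+1 (B (t j)) = - w i (A (t j)) = - w i
    (B (t j.+1))], until [A] meets the last [t] and gives 0. *)
Lemma dual_Zset_Bset r phi v : Zd r phi -> bd r v -> phi v = 0.
Proof.
case: r => [|[|r]] /=.
- by move=> _ ->; rewrite linear0.
- by move=> [w /dual_chainP[_ _ w3] ->] [u _ ->]; exact: w3.
move=> [w /dual_chainP[_ w2 w3] ->] [u [t [_ [_ t2 t3] ->]]].
rewrite linearD /= w3 add0r.
suff tele k : (k <= r)%N -> w k.+2 (B (t (r - k).+1)) = 0.
  by rewrite -(subnn r) tele.
elim: k => [|k IH] kr.
  by apply: oppr_inj; rewrite -w2 // subn0 t3 linear0 oppr0.
apply: oppr_inj; rewrite -w2 // t2; last by rewrite /= subnSK // ltnS leq_subr.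
by rewrite subnSK // IH ?oppr0 // ltnW.
Qed.

(** The same telescoping, now stopped by the last functional [t], which kills the image of [A]. *)
Lemma dual_Bset_Zset r phi v : Bd r phi -> Z r v -> phi v = 0.
Proof.
case: r => [|[|r]] /=.
- by move=> ->; rewrite zero_lfunE.
- by move=> [psi _ ->] [w [_ _ w3] ->]; rewrite dual_xE -/A w3 !linear0.
move=> [psi [t [_ /dual_chainP[_ t2 t3] ->]]] [w [_ w2 w3] ->].
rewrite add_lfunE dual_xE dual_yE -/A -/B w3 !linear0 add0r.
suff tele k : (k <= r)%N -> t (r - k).+1 (s (B (w k.+2))) = 0.
  by rewrite -(subnn r) tele // oppr0.
elim: k => [|k IH] kr.
  by rewrite -w2 // subn0 sA linearN /= t3 oppr0.
rewrite -w2 //.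
rewrite sA linearN /= t2; last by rewrite /= subnSK // ltnS leq_subr.
by rewrite opprK subnSK // -[RHS]oppr0 -(IH (ltnW kr)) sB linearN opprK.
Qed.

Lemma functional_eq0 phi : (forall v, phi (c v) = 0) ->
  (forall v, c v = 0 -> phi v = 0) -> forall v, phi v = 0.
Proof.
move=> phc phk v; have [p [cp _ _ dec]] := semisimple_ker_proj (@gl_c_ss F M).
by have [t ->] := dec v; rewrite linearD /= phc addr0 phk.
Qed.

(** For index at least 2, [phi (B (v 1))] vanishes on the chains [v] that define boundaries.
    [chain_dual] then produces the rest of a dual chain ending in [phi]. *)
Lemma Bset_annihilator r phi : (forall v, phi (c v) = 0) ->
  (forall v, bd r v -> phi v = 0) -> Zd r phi.
Proof.
move=> phc phB.
have phA : (0 < r)%N -> forall v, phi (A v) = 0.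
  move=> r0 v; rewrite -comp_lfunE; apply: functional_eq0 => {}v; rewrite comp_lfunE.
    by rewrite -cA phc.
  move=> cv; apply: phB; case: (r) r0 => [//|[|r']] _; first by exists v.
  by exists v, (fun=> 0); split; [|exact: chain0|rewrite linear0 addr0].
case: r phB phA => [|[|r]] phB phA.
- exact/dual_c_eq0.
- exists (fun=> phi) => //; apply/dual_chainP; split=> //; last exact: phA.
  by move=> [|[|i]].
have [|v vch|mu [mu0 muc muE]] :=
    @chain_dual F M c A B (@gl_c_ss F M) cA cB r.+1
      (fun i => if i == 0%N then (phi \o B)%VF else 0).
- by move=> i u; case: ifP => _; rewrite ?zero_lfunE // comp_lfunE -cB phc.
- rewrite big_ord_recl /= big1 ?addr0 => [|i _]; last by rewrite zero_lfunE.
  rewrite comp_lfunE; apply: phB; exists 0, v; split=> //; first exact: linear0.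
  by rewrite linear0 add0r.
(* With [phi] in place of [mu 0 = 0], one relation covers [k = 0] as well. *)
pose m k : sv_dual M := if k is 0 then phi else mu k.
have mE k u : (k < r.+1)%N -> m k.+1 (A u) = m k (B u).
  move=> kr; have := muE k u kr; case: (k) => [|k'] /=.
    by rewrite comp_lfunE mu0 zero_lfunE subr0 => ->.
  by rewrite zero_lfunE => /esym/subr0_eq.
(* Reversal puts [m 0 = phi] last; the alternating signs give the minus in [dual_chainP]. *)
exists (fun j => (-1) ^+ (r.+2 - j) *: m (r.+2 - j)%N); last first.
  by rewrite subnn expr0 scale1r.
apply/dual_chainP; split=> [i v _|[//|i] v /andP[_ ir]|v].
- by rewrite scale_lfunE; case: (_ - _)%N => [|k] /=; rewrite ?phc ?muc scaler0.
- have e : (r.+2 - i.+1 = (r.+2 - i.+2).+1)%N by rewrite subnSK.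
  rewrite e !scale_lfunE mE; last by rewrite !subSS ltnS leq_subr.
  by rewrite exprS mulN1r scaleNr.
by rewrite subnn expr0 scale1r phA.
Qed.

(** For [r > 0], [phi] kills the last entry of every chain, so [chain_dual] gives
    [phi = mu r \o A - mu r.-1 \o B]: a [dual_x] term, plus [dual_y] of the head of a dual chain
    when [r > 1]. *)
Lemma Zset_annihilator r phi : (forall v, phi (c v) = 0) ->
  (forall v, Z r v -> phi v = 0) -> Bd r phi.
Proof.
case: r => [|r] phc phZ.
  by apply/lfunP=> v; rewrite zero_lfunE; apply: functional_eq0.
have [|v vch|mu [mu0 muc muE]] :=
    @chain_dual F M c A B (@gl_c_ss F M) cA cB r.+1
      (fun i => if i == r then phi else 0).
- by move=> i u; case: ifP => _; rewrite ?zero_lfunE ?phc.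
- rewrite big_ord_recr /= eqxx big1 ?add0r => [|i _].
    by apply: phZ; exists v.
  by rewrite ltn_eqF // zero_lfunE.
have muE' i u : (i < r)%N -> mu i.+1 (A u) = mu i (B u).
  move=> ir; have := muE i u (ltnW ir).
  by rewrite ltn_eqF // zero_lfunE => /esym/subr0_eq.
have cs k : dual_c M (mu k \o s)%VF = 0.
  by apply/dual_c_eq0 => v; rewrite comp_lfunE sc muc.
have phE v : phi v = mu r.+1 (A v) - mu r (B v) by rewrite -muE // eqxx.
case: r {phZ muE} muE' phE => [|r] muE phE.
  exists (mu 1%N \o s)%VF => //; apply/lfunP=> v.
  by rewrite dual_xE comp_lfunE -/s sv_signK phE mu0 zero_lfunE subr0.
(* Composing with [s] undoes the parity twist. The chain descends from [mu r.+1] to [mu 1], where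
   [mu 1 \o A = mu 0 \o B = 0] ends it. *)
exists (mu r.+2 \o s)%VF, (fun i => (-1) ^+ i.+1 *: (mu (r.+2 - i)%N \o s)%VF).
split=> //; last first.
  apply/lfunP=> v; rewrite add_lfunE dual_xE dual_yE phE scale_lfunE !comp_lfunE.
  by rewrite -/s !sv_signK subn1 sqrrN expr1n scale1r.
apply/dual_chainP; split=> [i v _|i v /andP[i0 ir]|v].
- by rewrite scale_lfunE; move/dual_c_eq0: (cs (r.+2 - i)%N) => ->; rewrite scaler0.
- have e : (r.+2 - i = (r.+2 - i.+1).+1)%N by rewrite subnSK // ltnW.
  rewrite !scale_lfunE !comp_lfunE sA sB !linearN /= e muE; last first.
    by rewrite -ltnS -e ltn_subLR ?(leq_trans (ltnW ir)) // -addn1 addnC leq_add2r.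
  by rewrite [in RHS]exprS mulN1r scaleNr !opprK.
rewrite scale_lfunE comp_lfunE sA linearN /= subSn // subnn muE // mu0.
by rewrite zero_lfunE oppr0 scaler0.
Qed.

End DualChains.

(** * Bijective morphisms are isomorphisms *)

Section GmIso.
Variables (F : fieldType) (N N' : gmRep F) (f : gmHom N N').

Lemma gm_iso_bij : injective f -> (forall w, exists v, f v = w) -> gm_iso f.
Proof.
move=> injf surf; pose g : 'Hom(N', N) := (f^-1)%VF.
have gK w : f (g w) = w.
  by have [v <-] := surf w; rewrite limg_lfunVK // memv_img ?memvf.
have fK v : g (f v) = v by apply: injf; rewrite gK.
have g_even : even_map g.
  move=> p; apply/stableP=> w wp; rewrite sv_proj_mem; apply/eqP/injf.
  by rewrite even_proj ?gK ?sv_proj_id //; exact: gm_fun_even.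
have g_h w : g (gm_h N' w) = gm_h N (g w) by apply: injf; rewrite gm_fun_h !gK.
by exists (GmHom g_even g_h).
Qed.

End GmIso.

(** * The evaluation pairing and its perfectness *)

Section Pairing.
Variables (F : fieldType) (n : natinf).
Hypothesis n2 : (2%:R : F) != 0.
Implicit Type M : glRep F.

Let Z M := DSZ (gl_c M) (odd_op M true) (odd_op M (~~ true)) n.
Let B M := DSB (gl_c M) (odd_op M true) (odd_op M (~~ true)) n.
Let Zd M := DSZ (gl_c (gl_dual M)) (odd_op (gl_dual M) false)
  (odd_op (gl_dual M) (~~ false)) n.
Let Bd M := DSB (gl_c (gl_dual M)) (odd_op (gl_dual M) false)
  (odd_op (gl_dual M) (~~ false)) n.

(** One [r] beyond both stabilization points reduces [Infty] to a finite index, common to [M] and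
    its dual. *)
Lemma DS_dual_trunc M : exists r,
  [/\ Z M = vspace_of (Zset (gl_c M) (gl_y M) (gl_x M) r),
      B M = vspace_of (Bset (gl_c M) (gl_y M) (gl_x M) r),
      Zd M = vspace_of (Zset (dual_c M) (dual_x M) (dual_y M) r) &
      Bd M = vspace_of (Bset (dual_c M) (dual_x M) (dual_y M) r)].
Proof.
have [r1 H1] := DS_stable (gl_c M) (gl_y M) (gl_x M) n.
have [r2 H2] := DS_stable (dual_c M) (dual_x M) (dual_y M) n.
exists (trunc n (maxn r1 r2)).
by have [] := H1 _ (leq_maxl r1 r2); have [] := H2 _ (leq_maxr r1 r2).
Qed.

Lemma DSZ_c M v : v \in Z M -> gl_c M v = 0.
Proof. by have [r [-> _ _ _]] := DS_dual_trunc M => /ZsetP/Zset_c. Qed.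

Lemma dual_DSZ_c M (phi : gl_dual M) : phi \in Zd M -> forall v, phi (gl_c M v) = 0.
Proof. by have [r [_ _ -> _]] := DS_dual_trunc M => /ZsetP/dual_Zset_c. Qed.

Lemma dual_DSZ_DSB M (phi : gl_dual M) v : phi \in Zd M -> v \in B M -> phi v = 0.
Proof.
have [r [_ -> -> _]] := DS_dual_trunc M => /ZsetP phZ /BsetP.
exact: dual_Zset_Bset.
Qed.

Lemma dual_DSB_DSZ M (phi : gl_dual M) v : phi \in Bd M -> v \in Z M -> phi v = 0.
Proof.
have [r [-> _ _ ->]] := DS_dual_trunc M => /BsetP phB /ZsetP.
exact: dual_Bset_Zset.
Qed.

Lemma DSB_annihilator M (phi : gl_dual M) : (forall v, phi (gl_c M v) = 0) ->
  (forall v, v \in B M -> phi v = 0) -> phi \in Zd M.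
Proof.
have [r [_ -> -> _]] := DS_dual_trunc M => phc phB.
by apply/ZsetP/Bset_annihilator => // v vB; apply/phB/BsetP.
Qed.

Lemma DSZ_annihilator M (phi : gl_dual M) : (forall v, phi (gl_c M v) = 0) ->
  (forall v, v \in Z M -> phi v = 0) -> phi \in Bd M.
Proof.
have [r [-> _ _ ->]] := DS_dual_trunc M => phc phZ.
by apply/BsetP/Zset_annihilator => // v vZ; apply/phZ/ZsetP.
Qed.

(** Evaluation on chosen representatives; [prE] shows independence of the choice, since [Zd] kills
    [B] and [Bd] kills [Z]. *)
Let pr M (u : DS_xy n (gl_dual M)) (q : DS_yx n M) : F^o :=
  (sq_repr u : gl_dual M) (sq_repr q).

Let prE M phi v : phi \in Zd M -> v \in Z M ->
  pr (sq_pi (Zd M) (Bd M) phi) (sq_pi (Z M) (B M) v) = (phi : gl_dual M) v.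
Proof.
move=> phZ vZ; rewrite /pr.
set phi' := sq_repr _; set v' := sq_repr _.
transitivity ((phi' : gl_dual M) v).
  apply/subr0_eq; rewrite -linearB; apply: dual_DSZ_DSB; first exact: sq_reprZ.
  exact: sq_repr_pi.
apply/subr0_eq; rewrite -opp_lfunE -add_lfunE; apply: dual_DSB_DSZ vZ.
exact: sq_repr_pi.
Qed.

Let pr_linearr M (u : DS_xy n (gl_dual M)) : linear (pr u).
Proof.
move=> a q q'; rewrite -[u]sq_reprK -[q]sq_reprK -[q']sq_reprK -sq_pi_linear.
by rewrite !prE ?linearP ?memvD ?memvZ ?sq_reprZ.
Qed.

Let pr_linearl M a (u u' : DS_xy n (gl_dual M)) q :
  pr (a *: u + u') q = a *: pr u q + pr u' q.
Proof.
rewrite -[u]sq_reprK -[u']sq_reprK -[q]sq_reprK -sq_pi_linear.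
by rewrite !prE ?memvD ?memvZ ?sq_reprZ // add_lfunE scale_lfunE.
Qed.

Definition DS_pairing M : 'Hom(DS_xy n (gl_dual M), gm_dual (DS_yx n M)) :=
  linfun (fun u => linfun (pr u) : 'Hom(DS_yx n M, F^o)).

Let DS_pairing_pr M u q : DS_pairing M u q = pr u q.
Proof.
rewrite /DS_pairing linfunE; first by rewrite linfunE.
move=> a v w; apply/lfunP=> q'.
by rewrite add_lfunE scale_lfunE !linfunE // pr_linearl.
Qed.

Lemma DS_pairingE M phi v : phi \in Zd M -> v \in Z M ->
  DS_pairing M (sq_pi (Zd M) (Bd M) phi) (sq_pi (Z M) (B M) v) = (phi : gl_dual M) v.
Proof. by rewrite DS_pairing_pr; exact: prE. Qed.

Lemma DS_pairing_ext M (th th' : gm_dual (DS_yx n M)) :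
  (forall v, v \in Z M -> th (sq_pi (Z M) (B M) v) = th' (sq_pi (Z M) (B M) v)) ->
  th = th'.
Proof. by move=> e; apply/lfunP=> q; rewrite -[q]sq_reprK e ?sq_reprZ. Qed.

Fact DS_pairing_even M : even_map (DS_pairing M).
Proof.
move=> p; apply/stableP=> u /sq_partP[phi [phZ /dual_partP php] ->].
apply/dual_partP=> q /sq_partP[v [vZ vp] ->].
by rewrite DS_pairingE // php.
Qed.

Fact DS_pairing_h M u :
  DS_pairing M (gm_h (DS_xy n (gl_dual M)) u) =
  gm_h (gm_dual (DS_yx n M)) (DS_pairing M u).
Proof.
rewrite -[u]sq_reprK; move: (sq_repr u) (sq_reprZ u) => phi phZ.
apply: DS_pairing_ext => v vZ; rewrite gm_dual_hE.
rewrite (sq_mapE (@DSZ_h _ _ false n) (@DSB_h _ _ false n)) //.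
rewrite (sq_mapE (@DSZ_h _ M true n) (@DSB_h _ M true n)) //.
rewrite !DS_pairingE //; [exact: dual_hE | exact: DSZ_h | exact: (@DSZ_h _ _ false)].
Qed.

Definition DS_duality M : gmHom (DS_xy n (gl_dual M)) (gm_dual (DS_yx n M)) :=
  GmHom (@DS_pairing_even M) (@DS_pairing_h M).

Lemma DS_duality_iso M : gm_iso (DS_duality M).
Proof.
apply: gm_iso_bij => [u u' /= e|th /=].
  apply/subr0_eq; have : DS_pairing M (u - u') = 0 by rewrite linearB /= e subrr.
  rewrite -[u - u']sq_reprK; move: (sq_repr _) (sq_reprZ (u - u')) => phi phZ e0.
  apply/sq_pi0 => //; apply: DSZ_annihilator; first exact: dual_DSZ_c.
  by move=> v vZ; rewrite -DS_pairingE // e0 zero_lfunE.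
have [p [cp pid pc _]] := semisimple_ker_proj (@gl_c_ss F M).
(* A preimage of [th]: pull back to [Z], extended to all of [M] by zero on the image of [c] through
   [p]. *)
pose phi : gl_dual M := (th \o linfun (sq_pi (Z M) (B M)) \o p)%VF.
have phE v : phi v = th (sq_pi (Z M) (B M) (p v)) by rewrite !comp_lfunE lfunE.
have phZ : phi \in Zd M.
  apply: DSB_annihilator => v; first by rewrite phE pc !linear0.
  (* The inclusion of [B] in [Z] uses that 2 is invertible, so that [x] and [y] square to zero. *)
  move=> vB; have vZ : v \in Z M by apply/subvP: vB; exact: DSB_sub_DSZ.
  rewrite phE pid ?DSZ_c //.
  by have /(sq_pi0 _ vZ) -> := vB; rewrite linear0.
exists (sq_pi (Zd M) (Bd M) phi); apply: DS_pairing_ext => v vZ.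
by rewrite DS_pairingE // phE pid ?DSZ_c.
Qed.

(** On the classes of [phi] and [v], both sides evaluate to [phi (f v)]. *)
Lemma DS_duality_natural M N (f : glHom M N) (u : DS_xy n (gl_dual N)) :
  DS_duality M (DS_xy_map n (gl_dual_map f) u) =
  gm_dual_map (DS_yx_map n f) (DS_duality N u).
Proof.
rewrite -[u]sq_reprK; move: (sq_repr u) (sq_reprZ u) => phi phZ.
apply: DS_pairing_ext => v vZ.
transitivity (DS_pairing N (sq_pi (Zd N) (Bd N) phi)
  (DS_yx_map n f (sq_pi (Z M) (B M) v))); last first.
  by rewrite [gm_dual_map _ _]dual_mapE comp_lfunE.
rewrite (sq_mapE (@DSZ_f _ _ _ (gl_dual_map f) false n)
  (@DSB_f _ _ _ (gl_dual_map f) false n)) //.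
rewrite (sq_mapE (@DSZ_f _ _ _ f true n) (@DSB_f _ _ _ f true n)) //.
rewrite !DS_pairingE //.
- by rewrite /= dual_mapE comp_lfunE.
- exact: DSZ_f.
exact: (@DSZ_f _ _ _ (gl_dual_map f) false n).
Qed.

End Pairing.

(** * The duality over the complex numbers *)

Theorem theorem3p4 (R : realType) (n : natinf) :
  exists phi : forall M : glRep R[i],
      gmHom (DS_xy n (gl_dual M)) (gm_dual (DS_yx n M)),
    (forall M : glRep R[i], gm_iso (phi M)) /\
    (forall (M N : glRep R[i]) (f : glHom M N) (u : DS_xy n (gl_dual N)),
       phi M (DS_xy_map n (gl_dual_map f) u) =
       gm_dual_map (DS_yx_map n f) (phi N u)).
Proof.
have n2 : (2%:R : R[i]) != 0 by rewrite pnatr_eq0.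
exists (DS_duality n); split=> [M|M N f u]; first exact: DS_duality_iso.
exact: DS_duality_natural.
Qed.
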